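(* Fix $n\in\{0,1,2,\dots\}$, an initial distribution $\mu(db^{-1})$, and a channel of Class A, i.e. channel kernels satisfying $\mathbf{P}_{B_i|B^{i-1},A^i}(db_i|b^{i-1},a^i)=Q_i(db_i|b^{i-1},a_i)$, $i=0,\dots,n$. Let $$C^{FB,A}_{A^n\to B^n}:=\sup_{\{P_i\}\in\mathcal P_{[0,n]}} I(A^n\to B^n)=\sup_{\{P_i\}\in\mathcal P_{[0,n]}}\sum_{i=0}^n\mathbf E^{P}\Big\{\log\Big(\frac{dQ_i(\cdot|B^{i-1},A_i)}{d\Pi_i^{P}(\cdot|B^{i-1})}(B_i)\Big)\Big\}.$$ Then the following hold. **Part A.** The maximization of $I(A^n\to B^n)$ over $\mathcal P_{[0,n]}$ occurs in the subset $\overline{\mathcal P}^{A}_{[0,n]}\subset\mathcal P_{[0,n]}$ of channel input distributions satisfying $P_i(da_i|a^{i-1},b^{i-1})=\pi_i(da_i|b^{i-1})$ for almost all $(a^{i-1},b^{i-1})$, $i=0,\dots,n$ (that is, the supremum may be restricted to this subset without changing its value), and $$C^{FB,A}_{A^n\to B^n}=\sup_{\{\pi_i(da_i|b^{i-1}):\,i=0,\dots,n\}}\ \sum_{i=0}^n\mathbf E^{\pi}\Big\{\log\Big(\frac{dQ_i(\cdot|B^{i-1},A_i)}{d\Pi_i^{\pi_i}(\cdot|B^{i-1})}(B_i)\Big)\Big\},$$ where $\Pi_i^{\pi_i}(db_i|b^{i-1})=\int_{\mathbb A_i}Q_i(db_i|b^{i-1},a_i)\otimes\pi_i(da_i|b^{i-1})$,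 and $\mathbf E^{\pi}$ is taken with respect to $\mathbf P^{\pi}(da_i,db^i)=Q_i(db_i|b^{i-1},a_i)\otimes\pi_i(da_i|b^{i-1})\otimes\mathbf P^{\pi}(db^{i-1})$, with $\mathbf P^{\pi}(db^{i-1})=\mu(db^{-1})\otimes_{j=0}^{i-1}\Pi_j^{\pi_j}(db_j|b^{j-1})$. **Part B.** Let the transmission cost be $c_{0,n}(a^n,b^{n-1})=\sum_{i=0}^n\gamma_i$ and suppose that: (a) either $\gamma_i=\gamma_i^{A}(a_i,b^{i-1})$ for $i=0,\dots,n$, or $\gamma_i=\gamma_i^{B.K}(a_i,b_{i-K}^{i-1})$ for $i=0,\dots,n$, with $K$ a nonnegative integer; (b) the constrained and unconstrained problems are equivalent, i.e. $$C^{FB,A}_{A^n\to B^n}(\kappa):=\sup_{\{P_i\}\in\mathcal P_{[0,n]}(\kappa)}I(A^n\to B^n)=\inf_{s\ge0}\ \sup_{\{P_i\}\in\mathcal P_{[0,n]}}\Big\{I(A^n\to B^n)-s\big\{\mathbf E^{P}(c_{0,n}(A^n,B^{n-1}))-\kappa(n+1)\big\}\Big\}.$$ Then the maximization of $I(A^n\to B^n)$ over $\mathcal P_{[0,n]}(\kappa)$ occurs in $\overline{\mathcal P}^{A}_{[0,n]}(\kappa):=\overline{\mathcal P}^{A}_{[0,n]}\cap\mathcal P_{[0,n]}(\kappa)$ (that is, the supremum may be restricted to this subset without changing its value), and $$C^{FB,A}_{A^n\to B^n}(\kappa)=\sup_{\substack{\{\pi_i(da_i|b^{i-1}):\,i=0,\dots,n\}:\\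 \frac1{n+1}\mathbf E^{\pi}\{c_{0,n}(A^n,B^{n-1})\}\le\kappa}}\ \sum_{i=0}^n\mathbf E^{\pi}\Big\{\log\Big(\frac{dQ_i(\cdot|B^{i-1},A_i)}{d\Pi_i^{\pi_i}(\cdot|B^{i-1})}(B_i)\Big)\Big\}.$$
   Context: Spaces: the channel input alphabets $\mathbb A_i$ and output alphabets $\mathbb B_i$ are Polish spaces with Borel $\sigma$-algebras. Notation: $b^{i}=(b^{-1},b_0,\dots,b_i)$, where $b^{-1}=(\dots,b_{-2},b_{-1})\in\mathbb B^{-1}$ is the initial data, with fixed distribution $\mu(db^{-1})$; $a^i=(a_0,\dots,a_i)$ ($a^{-1}$ is empty, so $P_0(da_0|a^{-1},b^{-1})=P_0(da_0|b^{-1})$); $b_k^m=(b_k,\dots,b_m)$, which is empty if $k>m$ (so $K=0$ means $\gamma_i^{B.0}(a_i,b_{i}^{i-1})=\gamma_i^{B.0}(a_i)$). All conditional distributions are stochastic kernels (measurable in the conditioning variable); $\otimes$ denotes composition of kernels/measures. $\mathcal P_{[0,n]}$ is the set of all sequences of channel input kernels with feedback $\{P_i(da_i|a^{i-1},b^{i-1}):i=0,\dots,n\}$. A channel and $\{P_i\}$ induce the joint distribution $\mathbf P^{P}(da^n,db^n)=\mu(db^{-1})\otimes_{j=0}^n\big(Q_j(db_j|b^{j-1},a^j)\otimes P_j(da_j|a^{j-1},b^{j-1})\big)$, with expectation $\mathbf E^{P}$; $\Pi_i^{P}(db_i|b^{i-1})$ denotes the conditional distribution of $B_i$ given $B^{i-1}$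 under $\mathbf P^{P}$. When $P_i=\pi_i(da_i|b^{i-1})$ the superscript $P$ is replaced by $\pi$. Directed information: $I(A^n\to B^n)=\sum_{i=0}^n\mathbf E^{P}\{\log(\frac{dQ_i(\cdot|B^{i-1},A^i)}{d\Pi_i^{P}(\cdot|B^{i-1})}(B_i))\}=\sum_{i=0}^n I(A^i;B_i|B^{i-1})$, where each expectation is read as an averaged relative entropy (equal to $+\infty$ where absolute continuity fails). Transmission cost: a measurable function $c_{0,n}(a^n,b^{n-1})=\sum_{i=0}^n\gamma_i\in[0,\infty)$, and for $\kappa\in[0,\infty)$, $\mathcal P_{[0,n]}(\kappa)=\{\{P_i\}\in\mathcal P_{[0,n]}:\frac1{n+1}\mathbf E^{P}(c_{0,n}(A^n,B^{n-1}))\le\kappa\}$. *)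

(* Defs.v *)
From HB Require Import structures.
From mathcomp Require Import all_boot all_order all_algebra.
From mathcomp Require Import all_classical all_reals all_analysis.
From mathcomp Require Import measurable_realfun.

Set Implicit Arguments.
Unset Strict Implicit.
Unset Printing Implicit Defensive.
Import Order.TTheory GRing.Theory Num.Theory.
Import numFieldNormedType.Exports.

Local Open Scope classical_set_scope.
Local Open Scope ring_scope.
Local Open Scope ereal_scope.

Definition is_distance (R : realType) (T : Type) (d : T -> T -> R) : Prop :=
  [/\ forall x y, (0 <= d x y)%R,
      forall x y, d x y = 0%R <-> x = y,
      forall x y, d x y = d y x &
      forall x y z, (d x z <= d x y + d y z)%R].

Definition distance_complete (R : realType) (T : topologicalType)
    (d : T -> T -> R) : Prop :=
  forall u : nat -> T,
    (forall e : R, (0 < e)%R -> exists N : nat, forall m p : nat,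
       (N <= m)%N -> (N <= p)%N -> (d (u m) (u p) < e)%R) ->
    exists l : T, u @ \oo --> l.

Definition distance_induces_topology (R : realType) (T : topologicalType)
    (d : T -> T -> R) : Prop :=
  forall (x : T) (U : set T),
    nbhs x U <-> exists2 e : R, (0 < e)%R & [set y | (d x y < e)%R] `<=` U.

Definition polish (R : realType) (T : topologicalType) : Prop :=
  (exists2 D : set T, countable D & dense D) /\
  (exists d : T -> T -> R, [/\ is_distance d, distance_induces_topology d &
                               distance_complete d]).

Notation borel T := (g_sigma_algebraType (@open T)).

Section kernel_operations.
Context {R : realType}.

Section kernel_at.
Context d d' (X : measurableType d) (Y : measurableType d').
Context (k : R.-pker X ~> Y) (x : X).

(* [k x], seen as a bundled probability measure *)
Definition kernel_at : set Y -> \bar R := k x.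

HB.instance Definition _ := Measure.on kernel_at.

Let kernel_at_setT : kernel_at setT = 1.
Proof. exact: prob_kernel. Qed.

HB.instance Definition _ :=
  Measure_isProbability.Build _ _ _ kernel_at kernel_at_setT.

End kernel_at.

Section semidirect.
Context d d' (X : measurableType d) (Y : measurableType d').
Context (m : probability X R) (k : R.-pker X ~> Y).

(* the measure [m(dx) k(dy | x)] on [X * Y] *)
Definition semidirect (U : set (X * Y)) : \bar R :=
  \int[m]_x k x (xsection U x).

Let semidirect0 : semidirect set0 = 0.
Proof.
rewrite /semidirect (eq_integral (cst 0)) ?integral0// => x _.
by rewrite xsection0 measure0.
Qed.

Let semidirect_ge0 U : 0 <= semidirect U.
Proof. by apply: integral_ge0 => x _; exact: measure_ge0. Qed.

Let semidirect_sigma_additive : semi_sigma_additive semidirect.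
Proof.
move=> F mF tF mUF; rewrite [X in _ --> X](_ : _ =
  \int[m]_x (\sum_(n <oo) k x (xsection (F n) x))); last first.
  apply: eq_integral => x _; rewrite xsection_bigcup.
  apply/esym/cvg_lim => //; apply: measure_semi_sigma_additive.
  - by move=> i; exact: measurable_xsection.
  - exact: trivIset_xsection.
  - by rewrite -xsection_bigcup; exact: measurable_xsection.
apply/cvg_closeP; split.
  by apply: is_cvg_nneseries => n _ _; exact: semidirect_ge0.
rewrite closeE// integral_nneseries// => n.
by apply: measurable_fun_xsection_finite_kernel; rewrite inE.
Qed.

HB.instance Definition _ := isMeasure.Build _ _ _ semidirect
  semidirect0 semidirect_ge0 semidirect_sigma_additive.

Let semidirect_setT : semidirect setT = 1.
Proof.
rewrite /semidirect (eq_integral (cst 1)) ?integral_cst//; last first.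
  move=> x _; rewrite (_ : xsection setT x = setT) ?prob_kernel//.
  by apply/seteqP; split => // y _; rewrite /xsection/= inE.
by rewrite mul1e; exact: probability_setT.
Qed.

HB.instance Definition _ :=
  Measure_isProbability.Build _ _ _ semidirect semidirect_setT.

End semidirect.

Section kernel_precomp.
Context d d' d'' (X : measurableType d) (Y : measurableType d')
  (Z : measurableType d'').
Context (k : R.-pker Y ~> Z) (f : {mfun X >-> Y}).

Definition kernel_precomp (x : X) : {measure set Z -> \bar R} := k (f x).

Let measurable_kernel_precomp U :
  measurable U -> measurable_fun setT (kernel_precomp ^~ U).
Proof.
move=> mU.
exact: (measurableT_comp (measurable_kernel k U mU) (measurable_funPT f)).
Qed.

HB.instance Definition _ :=
  isKernel.Build _ _ _ _ _ kernel_precomp measurable_kernel_precomp.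

Let kernel_precomp_prob x : kernel_precomp x setT = 1.
Proof. exact: prob_kernel. Qed.

HB.instance Definition _ :=
  Kernel_isProbability.Build _ _ _ _ _ kernel_precomp kernel_precomp_prob.

End kernel_precomp.

Section mixture.
Context d d' d'' (X : measurableType d) (Y : measurableType d')
  (Z : measurableType d'').
Context (l : R.-pker X ~> Y) (k : R.-pker (X * Y) ~> Z).

(* [mixture l k x V = \int k(V | x, y) l(dy | x)] *)
Definition mixture : X -> {measure set Z -> \bar R} := mkcomp l k.

HB.instance Definition _ := Kernel.on mixture.

Let mixture_prob x : mixture x setT = 1.
Proof.
rewrite /mixture /= /kcomp (eq_integral (cst 1)) ?integral_cst//.
  by rewrite mul1e; exact: prob_kernel.
by move=> y _; rewrite prob_kernel.
Qed.

HB.instance Definition _ :=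
  Kernel_isProbability.Build _ _ _ _ _ mixture mixture_prob.

End mixture.

Section rearrangements.
Context d d' d'' (X : measurableType d) (Y : measurableType d')
  (Z : measurableType d'').

Definition swap_last (u : (X * Y) * Z) : (X * Z) * Y := ((u.1.1, u.2), u.1.2).

Let measurable_swap_last : measurable_fun setT swap_last.
Proof.
apply: measurable_fun_pair; last exact: measurableT_comp.
by apply: measurable_fun_pair => //; exact: measurableT_comp.
Qed.

HB.instance Definition _ := isMeasurableFun.Build _ _ _ _ swap_last
  measurable_swap_last.

Definition assoc_right (u : (X * Y) * Z) : X * (Y * Z) :=
  (u.1.1, (u.1.2, u.2)).

Let measurable_assoc_right : measurable_fun setT assoc_right.
Proof.
apply: measurable_fun_pair; first exact: measurableT_comp.
by apply: measurable_fun_pair => //; exact: measurableT_comp.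
Qed.

HB.instance Definition _ := isMeasurableFun.Build _ _ _ _ assoc_right
  measurable_assoc_right.

Definition second (u : X * Y) : Y := u.2.

HB.instance Definition _ := isMeasurableFun.Build _ _ _ _ second
  measurable_snd.

Definition pair_tt (x : X) : unit * X := (tt, x).

Let measurable_pair_tt : measurable_fun setT pair_tt.
Proof. exact: measurable_fun_pair. Qed.

HB.instance Definition _ := isMeasurableFun.Build _ _ _ _ pair_tt
  measurable_pair_tt.

End rearrangements.

Section conditional_distribution.
Context d d' (X : measurableType d) (Y : measurableType d').

Definition is_cond_dist (J : probability (X * Y)%type R)
    (k : R.-pker X ~> Y) : Prop :=
  forall (U : set X) (V : set Y), measurable U -> measurable V ->
    J (U `*` V) = \int[J]_(z in U `*` setT) k z.1 V.

(* A version of the conditional distribution of the second coordinate given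
   the first one under [J]. One exists as soon as [Y] is Polish, and two
   versions agree almost surely; the other branch is a placeholder. *)
Definition cond_dist (J : probability (X * Y)%type R) : R.-pker X ~> Y :=
  match pselect (exists k, is_cond_dist J k) with
  | left ex_k => sval (cid ex_k)
  | right _ => kdirac (@measurable_cst _ _ X Y setT point)
  end.

End conditional_distribution.

Definition relative_entropy d (T : measurableType d) (p q : probability T R) :
    \bar R :=
  if `[< p `<< q >] then
    \int[p]_x lne (Radon_Nikodym (charge_of_finite_measure p) q x)
  else +oo.

End kernel_operations.

HB.instance Definition _ (I : Type) (T : I -> ptopologicalType) :=
  Pointed.copy (prod_topology T) (forall i, T i).

Section histories.
Context (A : nat -> ptopologicalType) (B : int -> ptopologicalType).

Fixpoint in_disp (i : nat) : measure_display :=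
  if i is j.+1 then (in_disp j, (@open (A j)).-sigma).-prod%mdisp
  else default_measure_display.

(* [in_hist i] is the space of the inputs a^{i-1} = (a_0, ..., a_{i-1}) *)
Fixpoint in_hist (i : nat) : measurableType (in_disp i) :=
  if i is j.+1 then (in_hist j * borel (A j))%type else unit.

(* The initial data b^{-1} = (..., b_{-2}, b_{-1}): the coordinate of index
   [j : nat] is b_{-(j+1)}, since [Negz j] is the integer -(j+1). *)
Definition initial_data : ptopologicalType :=
  prod_topology (fun j : nat => B (Negz j)).

Fixpoint out_disp (i : nat) : measure_display :=
  if i is j.+1 then (out_disp j, (@open (B (Posz j))).-sigma).-prod%mdisp
  else (@open initial_data).-sigma%mdisp.

(* [out_hist i] is the space of b^{i-1} = (b^{-1}, b_0, ..., b_{i-1}) *)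
Fixpoint out_hist (i : nat) : measurableType (out_disp i) :=
  if i is j.+1 then (out_hist j * borel (B (Posz j)))%type
  else borel initial_data.

End histories.

Section windows.
Context (B : int -> ptopologicalType).

Fixpoint past_window_disp (K : nat) : measure_display :=
  if K is L.+1
  then ((@open (B (Negz L))).-sigma, past_window_disp L).-prod%mdisp
  else default_measure_display.

(* the space of b_{-K}^{-1} *)
Fixpoint past_window (K : nat) : measurableType (past_window_disp K) :=
  if K is L.+1 then (borel (B (Negz L)) * past_window L)%type else unit.

Fixpoint window_disp (i K : nat) : measure_display :=
  match i, K with
  | 0, _ => past_window_disp K
  | j.+1, 0 => default_measure_display
  | j.+1, L.+1 => (window_disp j L, (@open (B (Posz j))).-sigma).-prod%mdisp
  end.

(* the space of b_{i-K}^{i-1}; the time index i - K may be negative *)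
Fixpoint window (i K : nat) : measurableType (window_disp i K) :=
  match i, K with
  | 0, _ => past_window K
  | j.+1, 0 => unit
  | j.+1, L.+1 => (window j L * borel (B (Posz j)))%type
  end.

Fixpoint last_past (K : nat) (b : initial_data B) : past_window K :=
  if K is L.+1 then (b L, last_past L b) else tt.

(* the map b^{i-1} |-> b_{i-K}^{i-1} *)
Fixpoint last_outputs (i K : nat) : out_hist B i -> window i K :=
  match i, K with
  | 0, _ => fun b => last_past K b
  | j.+1, 0 => fun _ => tt
  | j.+1, L.+1 => fun b => (last_outputs L b.1, b.2)
  end.

End windows.

Section feedback.
Context {R : realType} (A : nat -> ptopologicalType)
  (B : int -> ptopologicalType).

(* The families are indexed by all of [nat]; with horizon [n], only the
   indices [i <= n] matter. *)

(* P_i(da_i | a^{i-1}, b^{i-1}) *)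
Definition input_kernels :=
  forall i : nat, R.-pker (in_hist A i * out_hist B i) ~> borel (A i).

(* pi_i(da_i | b^{i-1}) *)
Definition output_feedback_kernels :=
  forall i : nat, R.-pker (out_hist B i) ~> borel (A i).

(* Q_i(db_i | b^{i-1}, a^i) *)
Definition channel := forall i : nat,
  R.-pker (in_hist A i.+1 * out_hist B i) ~> borel (B (Posz i)).

(* Q_i(db_i | b^{i-1}, a_i) *)
Definition channel_A := forall i : nat,
  R.-pker (out_hist B i * borel (A i)) ~> borel (B (Posz i)).

Definition class_A (n : nat) (W : channel) (Q : channel_A) :=
  forall i, (i <= n)%N ->
  forall (a : in_hist A i.+1) (b : out_hist B i) (V : set (borel (B (Posz i)))),
    measurable V -> W i (a, b) V = Q i (b, a.2) V.

Definition input_of_feedback (pi : output_feedback_kernels) : input_kernels :=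
  fun i => kernel_precomp (pi i) (@second _ _ (in_hist A i) (out_hist B i)).

Section joint_law.
Context (mu : probability (out_hist B 0) R) (W : channel) (P : input_kernels).

(* law of (A^i, B^{i-1}), given the law of (A^{i-1}, B^{i-1}) *)
Definition add_input i
    (m : probability (in_hist A i * out_hist B i)%type R) :
    probability (in_hist A i.+1 * out_hist B i)%type R :=
  distribution (semidirect m (P i)) (@swap_last _ _ _ _ _ _).

(* law of (A^{i-1}, B^{i-1}) *)
Fixpoint history_law (i : nat) :
    probability (in_hist A i * out_hist B i)%type R :=
  if i is j.+1 then
    distribution (semidirect (add_input (history_law j)) (W j))
      (@assoc_right _ _ _ _ _ _)
  else distribution mu (@pair_tt _ _).

(* law of (A^i, B^{i-1}) *)
Definition input_law (i : nat) :
    probability (in_hist A i.+1 * out_hist B i)%type R :=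
  add_input (history_law i).

(* Pi_i^P(db_i | b^{i-1}) *)
Definition output_cond (i : nat) :
    R.-pker (out_hist B i) ~> borel (B (Posz i)) :=
  cond_dist (distribution (history_law i.+1) (@second _ _ _ _)).

(* The expectation of log (dQ_i / dPi_i^P)(B_i), as the average of the relative
   entropy of Q_i(. | B^{i-1}, A^i) with respect to Pi_i^P(. | B^{i-1}). *)
Definition directed_info (n : nat) : \bar R :=
  \sum_(i < n.+1) \int[input_law i]_z
    relative_entropy (kernel_at (W i) z) (kernel_at (output_cond i) z.2).

(* the same, with Q_i(. | B^{i-1}, A_i) *)
Definition directed_info_A (n : nat) (Q : channel_A) : \bar R :=
  \sum_(i < n.+1) \int[input_law i]_z
    relative_entropy (kernel_at (Q i) (z.2, z.1.2))
                     (kernel_at (output_cond i) z.2).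

Definition expected_cost (n : nat) (c : in_hist A n.+1 * out_hist B n -> R) :
    \bar R :=
  \int[input_law n]_z (c z)%:E.

Definition cost_le (n : nat) (c : in_hist A n.+1 * out_hist B n -> R)
    (kappa : R) : Prop :=
  (n.+1%:R^-1)%:E * expected_cost c <= kappa%:E.

(* P_i(da_i | a^{i-1}, b^{i-1}) = pi_i(da_i | b^{i-1}) for almost all
   (a^{i-1}, b^{i-1}), i = 0, ..., n *)
Definition depends_on_outputs_only (n : nat) : Prop :=
  exists pi : output_feedback_kernels, forall i, (i <= n)%N ->
    {ae history_law i, forall z, forall U : set (borel (A i)),
      measurable U -> P i z U = pi i z.2 U}.

End joint_law.

Section feedback_laws.
Context (mu : probability (out_hist B 0) R) (Q : channel_A)
  (pi : output_feedback_kernels).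

(* Pi_i^{pi_i}(db_i | b^{i-1}) *)
Definition output_kernel (i : nat) :
    R.-pker (out_hist B i) ~> borel (B (Posz i)) :=
  mixture (pi i) (Q i).

(* P^pi(db^{i-1}) *)
Fixpoint output_law (i : nat) : probability (out_hist B i) R :=
  if i is j.+1 then semidirect (output_law j) (output_kernel j) else mu.

Definition feedback_info (n : nat) : \bar R :=
  \sum_(i < n.+1) \int[semidirect (output_law i) (pi i)]_z
    relative_entropy (kernel_at (Q i) z) (kernel_at (output_kernel i) z.1).

End feedback_laws.

(* c_{0,n}(a^n, b^{n-1}) = \sum_{i <= n} gamma_i(a_i, b^{i-1}) *)
Fixpoint sum_costs (gamma : forall i : nat, borel (A i) * out_hist B i -> R)
    (n : nat) : in_hist A n.+1 * out_hist B n -> R :=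
  match n with
  | 0 => fun z => gamma 0%N (z.1.2, z.2)
  | m.+1 => fun z =>
      (sum_costs gamma (z.1.1, z.2.1) + gamma m.+1 (z.1.2, z.2))%R
  end.

(* gamma_i = gamma_i^A(a_i, b^{i-1}) *)
Definition cost_A (n : nat) (c : in_hist A n.+1 * out_hist B n -> R) : Prop :=
  exists2 gamma : forall i : nat, borel (A i) * out_hist B i -> R,
    forall i, (i <= n)%N -> measurable_fun setT (gamma i) &
    c = @sum_costs gamma n.

(* gamma_i = gamma_i^{B.K}(a_i, b_{i-K}^{i-1}) *)
Definition cost_B (K n : nat) (c : in_hist A n.+1 * out_hist B n -> R) : Prop :=
  exists2 gamma : forall i : nat, borel (A i) * window B i K -> R,
    forall i, (i <= n)%N -> measurable_fun setT (gamma i) &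
    c = @sum_costs (fun i z => gamma i (z.1, last_outputs K z.2)) n.

End feedback.

(* Main.v *)
Require Import Defs.
From HB Require Import structures.
From mathcomp Require Import all_boot all_order all_algebra.
From mathcomp Require Import all_classical all_reals all_analysis.
From mathcomp Require Import measurable_realfun.
From mathcomp Require Import lra.

Set Implicit Arguments.
Unset Strict Implicit.
Unset Printing Implicit Defensive.
Import Order.TTheory GRing.Theory Num.Theory.
Import numFieldNormedType.Exports.

Local Open Scope classical_set_scope.
Local Open Scope ring_scope.
Local Open Scope ereal_scope.

(* Given [P], let [pi i] be a conditional distribution of A_i given B^{i-1}
   under [P]; it exists because Polish spaces are Borel retracts of the line,
   where conditional quantile functions provide it. Since the channel at time i
   sees only (B^{i-1}, A_i), induction on i shows that [P] and [pi] give
   (B^{i-1}, A_i) the same law, hence the same output kernels almost surely and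
   the same directed information.

   The relative entropy of two kernels is not shown to be a measurable function
   of the conditioning variable. Integrals of arbitrary functions are lower
   integrals, and integrating out the past inputs preserves them because those
   inputs can be disintegrated as well.

   The cost is also the same under [P] and [pi], so each supremum restricts
   directly. As the individual gamma_i may be negative and not integrable, one
   first subtracts from gamma_i its conditional essential infimum m_i(b^{i-1})
   under [pi i]; the differences are almost surely nonnegative, and so is the
   sum of the m_i because the inputs vary independently in c >= 0. *)

(** * Lower integrals and semidirect products *)

Section lower_integral.
Context d (T : measurableType d) (R : realType).
Variable mu : {measure set T -> \bar R}.
Import HBNNSimple.

(** For an arbitrary nonnegative function the integral is a supremum over the simple functions below
    it, so monotonicity is inclusion of the two families. *)
Lemma ge0_le_lower_integral (f g : T -> \bar R) :
  (forall x, 0 <= f x) -> (forall x, f x <= g x) ->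
  \int[mu]_x f x <= \int[mu]_x g x.
Proof.
move=> f0 fg; have g0 x : 0 <= g x by exact: le_trans (fg x).
rewrite !ge0_integralTE//; apply: le_ereal_sup => _ [h hf <-].
by exists h => // x; exact: le_trans (fg x).
Qed.

Lemma ge0_lower_integral_le (f : T -> \bar R) (a : \bar R) :
  (forall x, 0 <= f x) ->
  (forall h : {nnsfun T >-> R}, (forall x, (h x)%:E <= f x) ->
    \int[mu]_x (h x)%:E <= a) ->
  \int[mu]_x f x <= a.
Proof.
move=> f0 hfa; rewrite ge0_integralTE//; apply: ge_ereal_sup => _ [h /= hf <-].
by rewrite -integralT_nnsfun; exact: hfa.
Qed.

(** A simple function below [f], set to zero on a null set containing the points where [f] and [g]
    differ, keeps its integral and lies below [g]. *)
Lemma ge0_le_ae_integral (f g : T -> \bar R) :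
  (forall x, 0 <= f x) -> (forall x, 0 <= g x) ->
  {ae mu, forall x, f x = g x} -> \int[mu]_x f x <= \int[mu]_x g x.
Proof.
move=> f0 g0 [N [mN muN0 Nfg]].
apply: ge0_lower_integral_le => // h hf.
rewrite (@ge0_negligible_integral _ _ _ mu setT N)//; last 2 first.
- exact/measurable_EFinP.
- by move=> x _; rewrite lee_fin.
rewrite setTD integral_mkcond.
apply: ge0_le_lower_integral => x.
  by apply: erestrict_ge0 => y _; rewrite lee_fin.
rewrite patchE; case: ifPn; last by move=> _; exact: g0.
rewrite inE => xN.
have <- : f x = g x by apply: contrapT => fg; exact/xN/Nfg.
exact: hf.
Qed.

Lemma ae_eq_lower_integral (f g : T -> \bar R) :
  {ae mu, forall x, f x = g x} -> \int[mu]_x f x = \int[mu]_x g x.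
Proof.
have H (u v : T -> \bar R) : (forall x, 0 <= u x) -> (forall x, 0 <= v x) ->
    {ae mu, forall x, u x = v x} -> \int[mu]_x u x = \int[mu]_x v x.
  move=> u0 v0 uv; apply/eqP; rewrite eq_le; apply/andP.
  split; apply: ge0_le_ae_integral => //.
  by apply: filterS uv => x ->.
move=> fg; rewrite integralE [RHS]integralE; congr (_ - _); apply: H => //.
- by apply: filterS fg => x; rewrite !funeposE => ->.
- by apply: filterS fg => x; rewrite !funenegE => ->.
Qed.

End lower_integral.

Section pushforward_lower_integral.
Context d d' (T : measurableType d) (U : measurableType d') (R : realType).
Import HBNNSimple.

(** Composition with [phi] sends simple functions below [f] to simple functions below [f \o phi].
    The converse inequality can fail: a simple function below [f \o phi] need not factor through
    [phi]. *)
Lemma ge0_lower_integral_pushforward_le (m : {measure set T -> \bar R})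
    (m' : {measure set U -> \bar R}) (phi : T -> U) (f : U -> \bar R) :
  measurable_fun setT phi ->
  (forall V, measurable V -> m' V = m (phi @^-1` V)) ->
  (forall y, 0 <= f y) ->
  \int[m']_y f y <= \int[m]_x f (phi x).
Proof.
move=> mphi m'E f0; apply: ge0_lower_integral_le => // h hf.
rewrite (@eq_measure_integral _ _ _ setT (pushforward m phi)); last first.
  by move=> V mV _; rewrite m'E.
rewrite ge0_integral_pushforward//; last 2 first.
- exact/measurable_EFinP.
- by move=> y _; rewrite lee_fin.
rewrite preimage_setT; apply: ge0_le_lower_integral => x /=; last exact: hf.
by rewrite lee_fin.
Qed.

Lemma ge0_integral_pushforward_eq (m : {measure set T -> \bar R})
    (m' : {measure set U -> \bar R}) (phi : T -> U) (f : U -> \bar R) :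
  measurable_fun setT phi ->
  (forall V, measurable V -> m' V = m (phi @^-1` V)) ->
  (forall y, 0 <= f y) -> measurable_fun setT f ->
  \int[m']_y f y = \int[m]_x f (phi x).
Proof.
move=> mphi m'E f0 mf.
rewrite (@eq_measure_integral _ _ _ setT (pushforward m phi)); last first.
  by move=> V mV _; rewrite m'E.
by rewrite ge0_integral_pushforward.
Qed.

Lemma lower_integral_split (m : {measure set T -> \bar R})
    (m' : {measure set U -> \bar R}) (phi : T -> U) :
  (forall f : U -> \bar R, (forall y, 0 <= f y) ->
    \int[m']_y f y = \int[m]_x f (phi x)) ->
  forall f : U -> \bar R, \int[m']_y f y = \int[m]_x f (phi x).
Proof.
move=> H f; rewrite integralE [RHS]integralE; congr (_ - _).
  by rewrite H//; apply: eq_integral => x _; rewrite !funeposE.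
by rewrite H//; apply: eq_integral => x _; rewrite !funenegE.
Qed.

End pushforward_lower_integral.

Section lower_integral_iso.
Context d d' (T : measurableType d) (U : measurableType d') (R : realType).

(** The one-sided inequality, applied to [phi] and to its inverse [psi], gives both directions. *)
Lemma lower_integral_iso (m : {measure set T -> \bar R})
    (m' : {measure set U -> \bar R}) (phi : T -> U) (psi : U -> T)
    (f : U -> \bar R) :
  measurable_fun setT phi -> measurable_fun setT psi ->
  cancel phi psi -> cancel psi phi ->
  (forall V, measurable V -> m' V = m (phi @^-1` V)) ->
  \int[m']_y f y = \int[m]_x f (phi x).
Proof.
move=> mphi mpsi phiK psiK m'E; apply: lower_integral_split => {}f f0.
apply/eqP; rewrite eq_le ge0_lower_integral_pushforward_le//=.
rewrite [leRHS](_ : _ = \int[m']_y (f \o phi) (psi y)); last first.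
  by apply: eq_integral => y _ /=; rewrite psiK.
rewrite (@eq_measure_integral _ _ _ setT (pushforward m' psi)); last first.
  move=> V mV _; rewrite /= /pushforward m'E; last first.
    by rewrite -[X in measurable X]setTI; exact: mpsi.
  by congr (m _); apply/seteqP; split => x /=; rewrite phiK.
by apply: ge0_lower_integral_pushforward_le => // y; exact: f0.
Qed.

End lower_integral_iso.

Section product_measures.
Context d d' (X : measurableType d) (Y : measurableType d') (R : realType).

Lemma eq_probability_rectangles (m1 m2 : probability (X * Y)%type R) :
  (forall U V, measurable U -> measurable V -> m1 (U `*` V) = m2 (U `*` V)) ->
  forall E, measurable E -> m1 E = m2 E.
Proof.
move=> m12 E mE.
apply: (measure_unique [set A `*` B | A in measurable & B in measurable]
  (fun=> setT)) => //.
- by rewrite -measurable_prod_measurableType.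
- move=> _ _ [A1 mA1 [B1 mB1 <-]] [A2 mA2 [B2 mB2 <-]].
  by rewrite -setXI; exists (A1 `&` A2); [exact: measurableI|];
    exists (B1 `&` B2); [exact: measurableI|].
- by move=> i; exists setT => //; exists setT => //; rewrite setXTT.
- by rewrite bigcup_const//; exists 0%N.
- by move=> _ [A mA [B mB <-]]; exact: m12.
- by move=> k; rewrite -ge0_fin_numE// fin_num_measure.
Qed.

Variables (m : probability X R) (k : R.-pker X ~> Y).

Lemma semidirect_rectangle U V : measurable U -> measurable V ->
  semidirect m k (U `*` V) = \int[m]_(x in U) k x V.
Proof.
move=> mU mV; rewrite [RHS]integral_mkcond; apply: eq_integral => x _.
rewrite patchE; case: ifPn => xU.
  by rewrite in_xsectionX.
by rewrite notin_xsectionX// measure0.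
Qed.

Lemma semidirect_fst U : measurable U -> semidirect m k (U `*` setT) = m U.
Proof.
move=> mU; rewrite semidirect_rectangle// (eq_integral (cst 1)).
  by rewrite integral_cst// mul1e.
by move=> x _; rewrite prob_kernel.
Qed.

Lemma ge0_integral_semidirect (f : X * Y -> \bar R) :
  (forall z, 0 <= f z) -> measurable_fun setT f ->
  \int[semidirect m k]_z f z = \int[m]_x \int[k x]_y f (x, y).
Proof.
move=> f0 mf.
(* [k' x] is the law of (x, y) with y drawn from [k x]. With [m] seen as a constant kernel on
   [unit], the semidirect product becomes a composition of kernels, whose integrals are iterated
   integrals. *)
pose k' := mixture k (kdirac (@measurable_id _ (X * Y)%type setT)).
have k'E x : \int[k' x]_z f z = \int[k x]_y f (x, y).
  rewrite [LHS]integral_kcomp//; apply: eq_integral => y _.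
  by rewrite integral_dirac// diracT mul1e.
pose l : R.-pker unit ~> X :=
  kprobability (@measurable_cst _ _ unit (pprobability X R) setT m).
pose k'' := kernel_precomp k' (@second _ _ unit X).
have <- : \int[kcomp l k'' tt]_z f z = \int[semidirect m k]_z f z.
  apply: eq_measure_integral => V mV _.
  apply: eq_integral => x _ /=; rewrite /kcomp/= /semidirect.
  rewrite -[in RHS](setIT (xsection V x)) -integral_indic//; last first.
    exact: measurable_xsection.
  apply: eq_integral => y _; rewrite diracE indicE; congr ((_ : bool)%:R%:E).
  by apply/idP/idP; rewrite !inE /xsection/= inE.
by rewrite integral_kcomp//; apply: eq_integral => x _ /=; exact: k'E.
Qed.

End product_measures.

(** * Polish spaces as Borel retracts of the real line *)

Section bit_coding.
Context (R : realType).
Implicit Types (b : nat -> bool) (r : R).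

(** Partial sums of the series of b_k / 3^(k+1). Using only the digits 0 and 1 in base 3 leaves a
    gap: a code is at most 1/6 if its first digit is 0 and at least 1/3 if it is 1, so the digits
    can be read back. *)
Fixpoint ternary_sum (n : nat) b : R :=
  if n is m.+1 then ((b 0%N)%:R + ternary_sum m (b \o S)) / 3 else 0.

Lemma ternary_sum_ge0 n b : (0 <= ternary_sum n b)%R.
Proof.
by elim: n b => //= n IHn b; rewrite divr_ge0// addr_ge0.
Qed.

Lemma ternary_sum_le n b : (ternary_sum n b <= 2^-1)%R.
Proof.
elim: n b => /= [b|n IHn b]; first by rewrite invr_ge0.
have := IHn (b \o S).
have : ((b 0%N)%:R <= 1 :> R)%R by case: (b 0%N).
lra.
Qed.

Lemma nondecreasing_ternary_sum b : nondecreasing_seq (ternary_sum ^~ b).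
Proof.
apply/nondecreasing_seqP => n; elim: n b => [b|n IHn b].
  exact: ternary_sum_ge0.
by have := IHn (b \o S) => /=; lra.
Qed.

Definition ternary_code b : R := limn (ternary_sum ^~ b).

Lemma cvg_ternary_sum b : ternary_sum ^~ b @ \oo --> ternary_code b.
Proof.
apply: nondecreasing_is_cvgn; first exact: nondecreasing_ternary_sum.
by exists 2^-1%R => _ [n _ <-]; exact: ternary_sum_le.
Qed.

Lemma ternary_code_ge0 b : (0 <= ternary_code b)%R.
Proof.
by apply: (limr_ge (cvgP _ (@cvg_ternary_sum b))); apply: nearW => n;
  exact: ternary_sum_ge0.
Qed.

Lemma ternary_code_le b : (ternary_code b <= 2^-1)%R.
Proof.
by apply: (limr_le (cvgP _ (@cvg_ternary_sum b))); apply: nearW => n;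
  exact: ternary_sum_le.
Qed.

Lemma ternary_codeS b :
  ternary_code b = (((b 0%N)%:R + ternary_code (b \o S)) / 3)%R.
Proof.
rewrite {1}/ternary_code; apply/cvg_lim => //; rewrite -cvg_shiftS /=.
by apply: cvgMl; apply: cvgD; [exact: cvg_cst|exact: cvg_ternary_sum].
Qed.

(** On codes the comparison with 1/3 yields the first digit and the map deletes it. The formula
    makes sense for every real, so decoding extends to Borel functions on the whole line. *)
Definition ternary_shift r : R := (3 * r - (3^-1 <= r)%R%:R)%R.

Definition ternary_bit (k : nat) r : bool := (3^-1 <= iter k ternary_shift r)%R.

Lemma ternary_bit0 b : (3^-1 <= ternary_code b)%R = b 0%N.
Proof.
rewrite ternary_codeS; have := ternary_code_le (b \o S).
have := ternary_code_ge0 (b \o S).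
by case: (b 0%N) => ? ? /=; [apply/idP|apply/negbTE; rewrite -ltNge]; lra.
Qed.

Lemma ternary_bitK b k : ternary_bit k (ternary_code b) = b k.
Proof.
elim: k b => [b|k IHk b]; first exact: ternary_bit0.
rewrite /ternary_bit iterSr {2}/ternary_shift ternary_bit0.
have -> : (3 * ternary_code b - (b 0%N)%:R)%R = ternary_code (b \o S).
  by rewrite ternary_codeS mulrC divfK// addrAC subrr add0r.
exact: IHk.
Qed.

Lemma measurable_ternary_shift : measurable_fun setT ternary_shift.
Proof.
apply: measurable_funB; first exact: measurable_funM.
rewrite (_ : (fun _ => _) = \1_[set r | (3^-1 <= r)%R]).
  apply: measurable_indic; rewrite -set_itvcy; exact: measurable_itv.
by apply/funext => r; rewrite indicE; congr (_%:R); congr nat_of_bool;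
   apply/idP/idP; rewrite inE.
Qed.

Lemma measurable_ternary_bit k : measurable [set r | ternary_bit k r].
Proof.
rewrite (_ : [set _ | _] = iter k ternary_shift @^-1` `[(3^-1)%R, +oo[%classic).
  have mk : measurable_fun setT (iter k ternary_shift : R -> R).
    elim: k => [|k IHk]; first exact: measurable_id.
    exact: (measurableT_comp measurable_ternary_shift).
  by rewrite -[X in measurable X]setTI; exact: (mk measurableT _ (measurable_itv _)).
by apply/seteqP; split=> r /=; rewrite in_itv/= andbT.
Qed.

End bit_coding.

(** * Measurability of sets defined by countable quantifiers *)

Section countable_logic.
Context d (T : measurableType d).
Implicit Type P : nat -> T -> Prop.

Lemma measurable_forall P : (forall k, measurable [set x | P k x]) ->
  measurable [set x | forall k, P k x].
Proof.
move=> mP; rewrite (_ : [set _ | _] = \bigcap_k [set x | P k x]).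
  exact: bigcapT_measurable.
by apply/seteqP; split => x /= Px k //; [move=> _|]; exact: Px.
Qed.

Lemma measurable_exists P : (forall k, measurable [set x | P k x]) ->
  measurable [set x | exists k, P k x].
Proof.
move=> mP; rewrite (_ : [set _ | _] = \bigcup_k [set x | P k x]).
  exact: bigcupT_measurable.
by apply/seteqP; split => x /= [k]; [move=> Pk|move=> _ Pk]; exists k.
Qed.

Lemma measurable_implies (a : Prop) (Q : T -> Prop) :
  measurable [set x | Q x] -> measurable [set x | a -> Q x].
Proof.
move=> mQ; have [ha|na] := pselect a.
  rewrite (_ : [set _ | _] = [set x | Q x])//.
  by apply/seteqP; split => x /= // /(_ ha).
rewrite (_ : [set _ | _] = setT)//.
by apply/seteqP; split => x //= _ /na.
Qed.

Lemma measurable_and (P Q : T -> Prop) : measurable [set x | P x] ->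
  measurable [set x | Q x] -> measurable [set x | P x /\ Q x].
Proof. by move=> mP mQ; exact: (measurableI _ _ mP mQ). Qed.

Lemma measurable_not (P : T -> Prop) : measurable [set x | P x] ->
  measurable [set x | ~ P x].
Proof. by move=> mP; exact: (measurableC mP). Qed.

End countable_logic.

(** [psi] is total, so that any kernel on the line can be mapped to [T]; the bounds on [phi] make
    the transported laws live on [0, 1]. *)
Definition real_retract (R : realType) d (T : measurableType d) :=
  exists (phi : T -> R) (psi : R -> T), [/\ measurable_fun setT phi,
    measurable_fun setT psi, cancel phi psi & forall t, (0 <= phi t <= 1)%R].

Section polish_real_retract.
Context (R : realType) (T : ptopologicalType).
Variables (dist : T -> T -> R) (q : nat -> T).
Hypothesis dist_dist : is_distance dist.
Hypothesis dist_topo : distance_induces_topology dist.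
Hypothesis dist_complete : distance_complete dist.
Hypothesis dense_q : forall t (e : R), (0 < e)%R -> exists i, (dist (q i) t < e)%R.

Let dist_sym x y : dist x y = dist y x. Proof. by case: dist_dist. Qed.
Let dist_tri x y z : (dist x z <= dist x y + dist y z)%R.
Proof. by case: dist_dist. Qed.
Let dist_eq x y : dist x y = 0%R -> x = y.
Proof. by case: dist_dist => _ H _ _; move/H. Qed.

Lemma open_dist_ball x (e : R) : open [set y | (dist x y < e)%R].
Proof.
rewrite openE => y /= xy; apply/dist_topo; exists (e - dist x y)%R.
  by rewrite subr_gt0.
by move=> z /= yz; have := dist_tri x y z; lra.
Qed.

Let inv_nat (n : nat) : R := n.+1%:R^-1.

Let inv_nat_gt0 n : (0 < inv_nat n)%R. Proof. by rewrite invr_gt0. Qed.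

Let inv_nat_lt (e : R) : (0 < e)%R -> exists N, forall n, (N <= n)%N -> (inv_nat n < e)%R.
Proof.
move=> e0; exists (Num.truncn e^-1) => n Nn.
rewrite invf_plt ?posrE// (lt_le_trans (truncnS_gt _))// ler_nat ltnS.
exact: Nn.
Qed.

(** [k] codes a pair [(i, n)], that is, the ball of radius 1/(n+1) about [q i]. By density of [q]
    these bits determine [t]. *)
Let bit (t : T) (k : nat) : bool :=
  if unpickle k is Some (i, n) then (dist (q i) t < inv_nat n)%R else false.

Let phi (t : T) : R := ternary_code R (bit t).

Let near_bit (i n : nat) (r : R) : bool := ternary_bit (pickle (i, n)) r.

Let near_bitE i n t : near_bit i n (phi t) = (dist (q i) t < inv_nat n)%R.
Proof. by rewrite /near_bit ternary_bitK /bit pickleK. Qed.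

(** The first centre whose ball of radius 1/(n+1) is reported by the digits of [r], with default 0
    if none is, as may happen when [r] is not a code. *)
Let index_spec n r (i : nat) : Prop :=
  (near_bit i n r /\ forall j, (j < i)%N -> ~ near_bit j n r) \/
  (i = 0%N /\ forall j, ~ near_bit j n r).

Let ex_index n r : exists i, index_spec n r i.
Proof.
have [ex|nex] := pselect (exists i, near_bit i n r).
  exists (ex_minn ex); left; case: ex_minnP => i ni min; split=> // j ji nj.
  by have := min _ nj; rewrite leqNgt ji.
by exists 0%N; right; split=> // j nj; apply: nex; exists j.
Qed.

Let index n r : nat := sval (cid (ex_index n r)).

Let indexP n r i : index n r = i <-> index_spec n r i.
Proof.
rewrite /index; case: cid => j /= ji; split => [<-//|].
case: ji => [[nj minj]|[-> nj]]; case=> [[ni mini]|[-> ni]] //.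
- case: (ltngtP i j) => // ij; first by case: (minj _ ij).
  by case: (mini _ ij).
- by case: (ni j).
- by case: (nj i).
Qed.

Let measurable_index n (P : nat -> Prop) : measurable [set r | P (index n r)].
Proof.
rewrite (_ : [set _ | _] = [set r | exists i, P i /\ index_spec n r i]); last first.
  apply/seteqP; split => r /=.
    by move=> Pi; exists (index n r); split => //; exact/indexP.
  by move=> [i [Pi /indexP ->]].
have mb i : measurable [set r | near_bit i n r] by exact: measurable_ternary_bit.
apply: measurable_exists => i; have [Pi|nPi] := pselect (P i); last first.
  by rewrite (_ : [set _ | _] = set0)//; apply/seteqP; split => r [].
rewrite (_ : [set _ | _] = [set r | index_spec n r i]); last first.
  by apply/seteqP; split => r /=; [case|].
apply: measurableU; apply: measurable_and => //.
- apply: measurable_forall => j; apply: measurable_implies.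
  exact: measurable_not.
- have [->|i0] := pselect (i = 0%N).
    by rewrite (_ : [set _ | _] = setT)//; apply/seteqP; split.
  by rewrite (_ : [set _ | _] = set0)//; apply/seteqP; split.
- by apply: measurable_forall => j; exact: measurable_not.
Qed.

Let u (r : R) (n : nat) : T := q (index n r).

Let u_phi t n : (dist (u (phi t) n) t < inv_nat n)%R.
Proof.
have [i it] := dense_q t (inv_nat_gt0 n).
rewrite /u; have /(_ erefl) := (indexP n (phi t) (index n (phi t))).1.
case=> [[]|[_]]; first by rewrite near_bitE.
by move=> /(_ i); rewrite near_bitE.
Qed.

(** Only radii 1/(k+1) are quantified over, which keeps the condition a countable combination of
    Borel sets. *)
Let cauchy (r : R) : Prop := forall k, exists N, forall m p, (N <= m)%N ->
  (N <= p)%N -> (dist (u r m) (u r p) < inv_nat k)%R.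

Let measurable_cauchy : measurable [set r | cauchy r].
Proof.
apply: measurable_forall => k; apply: measurable_exists => N.
apply: measurable_forall => m; apply: measurable_forall => p.
apply: measurable_implies; apply: measurable_implies.
rewrite (_ : [set _ | _] = [set r | exists i, (index m r = i) /\
    (dist (q i) (q (index p r)) < inv_nat k)%R]); last first.
  apply/seteqP; split => r /= => [H|[i [<-]//]].
  by exists (index m r).
apply: measurable_exists => i; apply: measurable_and.
  exact: (measurable_index m (fun j => j = i)).
exact: (measurable_index p (fun j => (dist (q i) (q j) < inv_nat k)%R)).
Qed.

Let is_limit (r : R) (l : T) := forall e : R, (0 < e)%R ->
  exists N, forall n, (N <= n)%N -> (dist l (u r n) < e)%R.

(** The centres [u (phi t) n] are within 1/(n+1) of [t], so their limit recovers [t]. Reals whose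
    sequence has no limit are sent to [point]. *)
Let psi (r : R) : T :=
  if pselect (exists l, is_limit r l) is left ex then sval (cid ex) else point.

Let is_limit_uniq r l l' : is_limit r l -> is_limit r l' -> l = l'.
Proof.
move=> rl rl'; apply: dist_eq; apply/eqP; case: eqP => // /eqP ll'.
have ll'0 : (0 < dist l l')%R by rewrite lt_def ll'; case: dist_dist => ->.
have e0 : (0 < dist l l' / 2)%R by lra.
have [N HN] := rl _ e0; have [N' HN'] := rl' _ e0.
have := HN (maxn N N') (leq_maxl _ _); have := HN' (maxn N N') (leq_maxr _ _).
by have := dist_tri l (u r (maxn N N')) l'; rewrite (dist_sym (u r _) l'); lra.
Qed.

Let psiE r l : is_limit r l -> psi r = l.
Proof.
move=> rl; rewrite /psi; case: pselect => [ex|]; last by case; exists l.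
by case: cid => /= l' rl'; exact: is_limit_uniq rl' rl.
Qed.

Let cauchyP r : cauchy r <-> exists l, is_limit r l.
Proof.
split=> [cr|[l rl] k]; last first.
  have e0 : (0 < inv_nat k / 2)%R by have := inv_nat_gt0 k; lra.
  have [N HN] := rl _ e0; exists N => m p /HN lm /HN lp.
  by have := dist_tri (u r m) l (u r p); rewrite (dist_sym (u r m) l); lra.
have /dist_complete[l ul] : forall e : R, (0 < e)%R ->
    exists N : nat, forall m p : nat,
    (N <= m)%N -> (N <= p)%N -> (dist (u r m) (u r p) < e)%R.
  move=> e /inv_nat_lt[k /(_ _ (leqnn k)) ke]; have [N HN] := cr k.
  by exists N => m p /HN /[apply] /lt_trans; apply.
exists l => e e0; have /ul [N _ HN] : nbhs l [set y | (dist l y < e)%R].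
  by apply/dist_topo; exists e.
by exists N => n Nn; exact: HN.
Qed.

Let psi_phi : cancel phi psi.
Proof.
move=> t; apply: psiE => e e0; have [N HN] := inv_nat_lt e0; exists N => n /HN ne.
by rewrite dist_sym (lt_trans (u_phi t n)).
Qed.

(** A limit lies in an open set exactly when, for some fixed radius, the balls about all late terms
    are contained in it. Membership thus becomes a countable condition on the indices. *)
Let psi_preimage (U : set T) : open U -> psi @^-1` U =
  [set r | cauchy r /\ exists k N, forall n, (N <= n)%N ->
    [set y | (dist (u r n) y < inv_nat k)%R] `<=` U] `|`
  [set r | U point /\ ~ cauchy r].
Proof.
rewrite openE => oU; apply/seteqP; split=> r /=.
- have [cr|ncr] := pselect (cauchy r).
    have [l rl] := (cauchyP r).1 cr.
    rewrite (psiE rl) => Ul; left; split => //.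
    have /dist_topo[e e0 eU] := oU _ Ul.
    have /inv_nat_lt[k /(_ _ (leqnn k)) ke] : (0 < e / 2)%R by lra.
    have [N HN] := rl _ (inv_nat_gt0 k); exists k, N => n /HN ln y /= ny.
    by apply: eU => /=; have := dist_tri l (u r n) y; lra.
  rewrite /psi; case: pselect => [ex|_ Up]; last by right.
  by case: ncr; exact/cauchyP.
- case=> [[cr [k [N HN]]]|[Up ncr]].
    have [l rl] := (cauchyP r).1 cr.
    rewrite (psiE rl); have [N' HN'] := rl _ (inv_nat_gt0 k).
    apply: (HN (maxn N N') (leq_maxl _ _)) => /=.
    by rewrite dist_sym; exact/HN'/leq_maxr.
  by rewrite /psi; case: pselect => // ex; case: ncr; exact/cauchyP.
Qed.

Lemma complete_separable_real_retract : real_retract R (borel T).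
Proof.
have phi01 t : (0 <= phi t <= 1)%R.
  by rewrite ternary_code_ge0 (le_trans (ternary_code_le _ _))//; lra.
exists phi, psi; split => //.
- have mbit k : measurable [set t : borel T | bit t k].
    rewrite /bit; case: unpickle => [[i n]|]; last first.
      by rewrite (_ : [set _ | _] = set0)//; apply/seteqP; split.
    by apply: sub_sigma_algebra; exact: open_dist_ball.
  apply: (@measurable_fun_cvg _ (borel T) _ setT
    (fun n t => ternary_sum R n (bit t))); last first.
    by move=> t _; exact: cvg_ternary_sum.
  (* Generalised to shifted bit sequences because [ternary_sum] recurses on the tail of its
     argument. *)
  suff H n : forall k,
      measurable_fun setT (fun t : borel T => ternary_sum R n (fun j => bit t (k + j))).
    by move=> n; apply: eq_measurable_fun (H n 0%N).
  elim: n => [k|n IHn k]; first exact: measurable_cst.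
  apply: measurable_funM; last exact: measurable_cst.
  apply: measurable_funD.
    rewrite (_ : (fun _ => _) = \1_[set t : borel T | bit t (k + 0)%N]).
      exact: measurable_indic.
    by apply/funext => r; rewrite indicE; congr (_%:R); congr nat_of_bool;
       apply/idP/idP; rewrite inE.
  rewrite (_ : (fun _ => _) =
      (fun t : borel T => ternary_sum R n (fun j => bit t (k.+1 + j)%N))) //.
  by apply/funext => t; congr ternary_sum; apply/funext => j /=; rewrite addnS.
- apply: (@measurability _ _ _ (borel T) setT psi (@open T)) => // _ [U oU <-].
  rewrite setTI psi_preimage//.
  apply: measurableU; apply: measurable_and => //.
  + apply: measurable_exists => k; apply: measurable_exists => N.
    apply: measurable_forall => n; apply: measurable_implies.
    exact: (measurable_index n (fun j => [set y | (dist (q j) y < inv_nat k)%R] `<=` U)).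
  + have [Up|Up] := pselect (U point).
      by rewrite (_ : [set _ | _] = setT)//; apply/seteqP; split.
    by rewrite (_ : [set _ | _] = set0)//; apply/seteqP; split.
  + exact: measurable_not.
Qed.

End polish_real_retract.

Lemma polish_real_retract (R : realType) (T : ptopologicalType) :
  polish R T -> real_retract R (borel T).
Proof.
move=> [[D cD dD] [dist [dist_dist dist_topo dist_complete]]].
have /countable_injP[f injf] := cD.
(* [q] inverts an injection of [D] into the naturals, with [point] at the indices that are not
   hit. *)
pose q n : T := if pselect (exists t, D t /\ f t = n) is left ex
  then sval (cid ex) else point.
apply: (@complete_separable_real_retract _ _ dist q) => // t e e0.
have [] := dD [set y | (dist t y < e)%R].
- by exists t => /=; case: dist_dist => _ H _ _; rewrite (H t t).2.
- exact: open_dist_ball.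
move=> y [/= ty Dy]; exists (f y); rewrite /q; case: pselect => [ex|]; last first.
  by case; exists y.
case: cid => /= z [Dz fz]; have -> : z = y by apply: injf => //; rewrite inE.
by case: dist_dist => _ _ -> _.
Qed.

(** * Disintegration *)

Definition first_coord (X Y : Type) (u : X * Y) : X := u.1.

HB.instance Definition _ d d' (X : measurableType d) (Y : measurableType d') :=
  isMeasurableFun.Build _ _ (X * Y)%type X (@first_coord X Y) measurable_fst.

Definition swap_pair (X Y : Type) (u : X * Y) : Y * X := (u.2, u.1).

Lemma measurable_swap_pair d d' (X : measurableType d) (Y : measurableType d') :
  measurable_fun setT (@swap_pair X Y).
Proof. exact: measurable_fun_pair. Qed.

HB.instance Definition _ d d' (X : measurableType d) (Y : measurableType d') :=
  isMeasurableFun.Build _ _ (X * Y)%type (Y * X)%type (@swap_pair X Y)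
    (@measurable_swap_pair _ _ X Y).

Section coordinate_laws.
Context d d' (X : measurableType d) (Y : measurableType d') (R : realType).
Variable J : probability (X * Y)%type R.

Definition fst_law : probability X R := distribution J (@first_coord X Y).

Definition swap_law : probability (Y * X)%type R :=
  distribution J (@swap_pair X Y).

Lemma fst_lawE U : fst_law U = J (U `*` setT).
Proof. by congr (J _); apply/seteqP; split=> -[x y] /=; [|case]. Qed.

Lemma swap_lawE V U : swap_law (V `*` U) = J (U `*` V).
Proof. by congr (J _); apply/seteqP; split=> -[x y] /= []. Qed.

End coordinate_laws.

Lemma ge0_integral_ae_eq d (T : measurableType d) (R : realType)
    (mu : {measure set T -> \bar R}) (f g : T -> \bar R) :
  measurable_fun setT f -> measurable_fun setT g ->
  (forall x, 0 <= f x) -> (forall x, 0 <= g x) -> \int[mu]_x f x < +oo ->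
  (forall U, measurable U -> \int[mu]_(x in U) f x = \int[mu]_(x in U) g x) ->
  {ae mu, forall x, f x = g x}.
Proof.
move=> mf mg f0 g0 foo fg.
have : ae_eq mu setT f g.
  apply: integral_ae_eq => //.
    apply/integrableP; split => //.
    by under eq_integral do rewrite gee0_abs//.
  by move=> E _ mE; exact: fg.
by apply: filterS => x; exact.
Qed.

(** * Conditional probabilities of a fixed event *)

Section conditional_density.
Context d d' (X : measurableType d) (Y : measurableType d') (R : realType).
Variable J : probability (X * Y)%type R.

Let M := fst_law J.

Section slice.
Context (V : set Y) (mV : measurable V).

Definition slice (W : measurable V) (U : set X) : \bar R := J (U `*` V).

Let slice0 : slice mV set0 = 0.
Proof. by rewrite /slice set0X measure0. Qed.

Let slice_ge0 U : 0 <= slice mV U. Proof. exact: measure_ge0. Qed.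

Let slice_sigma_additive : semi_sigma_additive (slice mV).
Proof.
move=> F mF tF mUF.
rewrite [X in _ --> X](_ : _ = J (\bigcup_n (F n `*` V))); last first.
  by rewrite /slice setX_bigcupl.
apply: measure_semi_sigma_additive.
- by move=> n; exact: measurableX.
- apply/trivIsetP => m n _ _ mn; move/trivIsetP : tF => /(_ m n Logic.I Logic.I mn).
  by rewrite -setXI => ->; rewrite set0X.
- by apply: bigcupT_measurable => n; exact: measurableX.
Qed.

HB.instance Definition _ := isMeasure.Build _ _ _ (slice mV)
  slice0 slice_ge0 slice_sigma_additive.

Let slice_fin : fin_num_fun (slice mV).
Proof. by move=> U mU; rewrite fin_num_measure//; exact: measurableX. Qed.

HB.instance Definition _ := Measure_isFinite.Build _ _ _ (slice mV) slice_fin.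

End slice.

(** The measure [slice mV] is dominated by the first marginal, so Radon-Nikodym applies. *)
Let ex_density V : measurable V -> exists f : X -> \bar R,
  [/\ measurable_fun setT f, forall x, 0 <= f x &
      forall U, measurable U -> J (U `*` V) = \int[M]_(x in U) f x].
Proof.
move=> mV; have [|f [f0 intf fE]] := @radon_nikodym_finite _ _ _ M (slice mV).
  apply/null_content_dominatesP => U mU MU; apply/eqP; rewrite -measure_le0 -MU.
  rewrite [leRHS](fst_lawE J U); apply: le_measure; rewrite ?inE//.
  - exact: measurableX.
  - exact: measurableX.
  - by move=> z [].
by exists f; split => //; exact: measurable_int intf.
Qed.

Let density_finite V f : measurable V ->
  (forall U, measurable U -> J (U `*` V) = \int[M]_(x in U) f x) ->
  \int[M]_x f x < +oo.
Proof.
move=> mV <-//; rewrite -ge0_fin_numE// fin_num_measure//; exact: measurableX.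
Qed.

(** A version of the conditional probability of [V] given the first coordinate. The bounds hold at
    every point and not just almost surely, so that suprema of such versions exist pointwise. *)
Definition is_density V (F : X -> R) :=
  [/\ measurable_fun setT F, forall x, (0 <= F x <= 1)%R &
      forall U, measurable U -> J (U `*` V) = \int[M]_(x in U) (F x)%:E].

(** Almost surely [F'] is [F] plus a density of the difference of the two events, which is
    nonnegative. *)
Lemma le_density V V' F F' : measurable V -> measurable V' -> V `<=` V' ->
  is_density V F -> is_density V' F' -> {ae M, forall x, (F x <= F' x)%R}.
Proof.
move=> mV mV' VV' [mF F01 FE] [mF' F'01 F'E].
have [|G [mG G0 GE]] := @ex_density (V' `\` V); first exact: measurableD.
have : {ae M, forall x, (F' x)%:E = (F x)%:E + G x}.
  apply: ge0_integral_ae_eq => //.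
  - exact/measurable_EFinP.
  - by apply: emeasurable_funD => //; exact/measurable_EFinP.
  - by move=> x; rewrite lee_fin; case/andP: (F'01 x).
  - by move=> x; rewrite adde_ge0// lee_fin; case/andP: (F01 x).
  - exact: (density_finite mV').
  - move=> U mU; rewrite ge0_integralD//; last 3 first.
    + by move=> x _; rewrite lee_fin; case/andP: (F01 x).
    + by apply: measurable_funTS; exact/measurable_EFinP.
    + exact: measurable_funTS.
    rewrite -FE// -GE// -F'E// -measureU//.
    + congr (J _); apply/seteqP; split=> -[x y] /= [].
      * by move=> Ux V'y; have [Vy|Vy] := pselect (V y); [left|right].
      * by move=> [Ux /VV'].
      * by move=> [Ux []].
    + exact: measurableX.
    + by apply: measurableX => //; exact: measurableD.
    + by apply/seteqP; split=> -[x y] //= [[_ Vy] [_ []]].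
apply: filterS => x F'x; rewrite -lee_fin F'x leeDl//; exact: G0.
Qed.

(** Densities of [V] and of its complement add up to 1 almost surely, so truncating the first at 1
    changes it only on a null set. *)
Lemma exists_density V : measurable V -> exists F, is_density V F.
Proof.
move=> mV; have [f [mf f0 fE]] := ex_density mV.
have [g [mg g0 gE]] := ex_density (measurableC mV).
have fg1 : {ae M, forall x, 1 = f x + g x}.
  apply: ge0_integral_ae_eq => //.
  - exact: emeasurable_funD.
  - by move=> x; rewrite adde_ge0.
  - by rewrite integral_cst// mul1e -ge0_fin_numE// fin_num_measure.
  - move=> U mU; rewrite integral_cst// mul1e ge0_integralD//; last 2 first.
    + exact: measurable_funTS.
    + exact: measurable_funTS.
    rewrite -fE// -gE// -measureU//.
    + rewrite [LHS](fst_lawE J U); congr (J _); apply/seteqP; split=> -[x y] /=;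
        last by case; case.
      by move=> [Ux _]; have [Vy|Vy] := pselect (V y); [left|right].
    + exact: measurableX.
    + by apply: measurableX => //; exact: measurableC.
    + by apply/seteqP; split=> -[x y] //= [[_ Vy] [_ []]].
exists (fun x => fine (mine (f x) 1)).
have fin1 x : mine (f x) 1 \is a fin_num.
  rewrite ge0_fin_numE; first by rewrite gt_min ltry orbT.
  by rewrite le_min f0 lee01.
split.
- apply: measurableT_comp => //; exact: measurable_mine.
- move=> x; rewrite -!lee_fin fineK// le_min f0 lee01/=.
  by rewrite ge_min lexx orbT.
- move=> U mU; rewrite fE// integral_mkcond [RHS]integral_mkcond.
  apply: ae_eq_lower_integral; apply: filterS fg1 => x fg1.
  rewrite !patchE; case: ifPn => // _; rewrite fineK//.
  by apply/esym/min_idPl; rewrite fg1 leeDl.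
Qed.

End conditional_density.

(** With [U] fixed both sides are finite measures on the line, and the open rays are a generating
    family closed under intersection. *)
Lemma eq_probability_rays d (X : measurableType d) (R : realType)
    (J1 J2 : probability (X * R)%type R) :
  (forall (U : set X) (r : R), measurable U ->
    J1 (U `*` `]-oo, r[%classic) = J2 (U `*` `]-oo, r[%classic)) ->
  forall E, measurable E -> J1 E = J2 E.
Proof.
move=> J12; apply: eq_probability_rectangles => U V mU mV.
have sliceE (J : probability (X * R)%type R) W :
    J (U `*` W) = slice (swap_law J) mU W.
  by rewrite /slice swap_lawE.
rewrite !sliceE.
pose m1 : {measure set R -> \bar R} := slice (swap_law J1) mU.
pose m2 : {measure set R -> \bar R} := slice (swap_law J2) mU.
apply: (@measure_unique _ R _ (@RGenInftyO.G R) (fun n => `]-oo, n%:R[%classic)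
  _ _ _ _ m1 m2) => //.
- exact: RGenInftyO.measurableE.
- move=> _ _ [x ->] [y ->]; exists (Num.min x y).
  by apply/seteqP; split=> z /=; rewrite !in_itv/= lt_min; [case=> -> ->|move/andP].
- by move=> n; exists n%:R.
- apply/seteqP; split => // x _; exists (Num.truncn x).+1 => //=.
  by rewrite in_itv/= truncnS_gt.
- by move=> _ [r ->]; rewrite [LHS]swap_lawE [RHS]swap_lawE J12.
- move=> n; rewrite -ge0_fin_numE// fin_num_measure//; exact: measurable_itv.
Qed.

(** * Disintegration over the unit interval by conditional quantiles *)

Section disintegration_unit_interval.
Context d (X : measurableType d) (R : realType).
Variable J : probability (X * R)%type R.
Hypothesis J01 : J (setT `*` ~` `[0%R, 1%R]%classic) = 0.

Let M := fst_law J.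

(** Nonnegative thresholds suffice because [J] is carried by [0, 1], and they bound the infimum
    defining [quantile] from below. *)
Let q (j : nat) : R := `|ratr (odflt 0%R (unpickle j))|%R.

Let q_ge0 j : (0 <= q j)%R. Proof. exact: normr_ge0. Qed.

Let q_dense (r s : R) : (0 <= r)%R -> (r < s)%R -> exists j, (r < q j < s)%R.
Proof.
move=> r0 rs; have [p] := rat_in_itvoo rs; rewrite in_itv/= => /andP[rp ps].
exists (pickle p); rewrite /q pickleK/= ger0_norm ?rp//.
exact: le_trans r0 (ltW rp).
Qed.

Let F_ex j : {F : X -> R | is_density J `]-oo, q j]%classic F}.
Proof. by apply/cid/exists_density; exact: measurable_itv. Qed.

Let F j := sval (F_ex j).

Let F_density j : is_density J `]-oo, q j]%classic (F j).
Proof. by rewrite /F; case: F_ex. Qed.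

Let F01 j x : (0 <= F j x <= 1)%R. Proof. by case: (F_density j). Qed.

(** [F j] is the conditional distribution function at [q j]; the infimum over [j] is its generalised
    inverse at level [z.2]. An index that does not exceed the level contributes 1, the right end of
    the interval carrying [J]. *)
Let g (j : nat) (z : X * measurableTypeR R) : R := if (z.2 < F j z.1)%R then q j else 1%R.

Let g_lb z : has_lbound (range (g ^~ z)).
Proof.
by exists 0%R => _ [j _ <-]; rewrite /g; case: ifP => // _; exact: q_ge0.
Qed.

Let quantile (z : X * measurableTypeR R) : R := infs (g ^~ z) 0%N.

Let measurable_quantile : measurable_fun setT quantile.
Proof.
apply: measurable_fun_infs => // j; apply: measurable_fun_ifT => //.
apply: measurable_fun_ltr => //.
by apply: measurableT_comp => //; case: (F_density j).
Qed.

Let quantile_lt z r : (quantile z < r)%R <-> exists j, (g j z < r)%R.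
Proof.
rewrite /quantile /infs/=; split.
  move=> /inf_lt; case; first by exists (g 0%N z), 0%N.
  by move=> _ [j _ <-] ?; exists j.
move=> [j]; apply: le_lt_trans; apply: ge_inf; last by exists j.
exact: has_lbound_sdrop.
Qed.

Let quantile_kernel : R.-pker X ~> R :=
  mixture (kprobability (@measurable_cst _ _ X (pprobability (measurableTypeR R) R) setT
             (uniform_prob (@ltr01 R) : probability (measurableTypeR R) R)))
          (kdirac measurable_quantile).

Let quantile_kernelE x V : measurable V -> quantile_kernel x V =
  lebesgue_measure ([set u | V (quantile (x, u))] `&` `[0%R, 1%R]%classic).
Proof.
move=> mV; rewrite /quantile_kernel/= /kcomp/=.
have mVx : measurable [set u | V (quantile (x, u))].
  rewrite -[X in measurable X]setTI.
  by apply: (measurableT_comp measurable_quantile) => //; exact: pair1_measurable.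
rewrite (eq_integral (fun u => (\1_[set u | V (quantile (x, u))] u)%:E)); last first.
  by move=> u _; rewrite diracE indicE; congr ((_ : bool)%:R%:E).
rewrite integral_uniform//; last first.
  by apply/measurable_EFinP; exact: measurable_indic.
by rewrite subr0 invr1 mul1e integral_indic//; exact: measurable_itv.
Qed.

(** For [r] at most 1 the quantile is below [r] exactly at levels below some [F j x] with [q j < r],
    so this is the mass the kernel gives to the open ray. Taking a supremum copes with [F] being
    monotone in the threshold only almost surely. *)
Let S (r : R) (x : X) : R := sup (range (fun j => if (q j < r)%R then F j x else 0%R)).

Let S_ub r x : has_ubound (range (fun j => if (q j < r)%R then F j x else 0%R)).
Proof.
by exists 1%R => _ [j _ <-]; case: ifP => // _; case/andP: (F01 j x).
Qed.

Let S01 r x : (0 <= S r x <= 1)%R.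
Proof.
apply/andP; split.
  apply: (@le_trans _ _ (if (q 0%N < r)%R then F 0%N x else 0%R)).
    by case: ifP => // _; case/andP: (F01 0%N x).
  by apply: ub_le_sup => //; exists 0%N.
apply: ge_sup; first by eexists; exists 0%N.
by move=> _ [j _ <-]; case: ifP => // _; case/andP: (F01 j x).
Qed.

Let le_S j r x : (q j < r)%R -> (F j x <= S r x)%R.
Proof. by move=> qr; apply: ub_le_sup => //; exists j => //; rewrite qr. Qed.

Let quantile_kernel_ray x r : (r <= 1)%R ->
  quantile_kernel x `]-oo, r[%classic = (S r x)%:E.
Proof.
move=> r1; rewrite quantile_kernelE; last exact: measurable_itv.
rewrite (_ : _ `&` _ = `[0%R, S r x[%classic).
  rewrite lebesgue_measure_itv/= lte_fin; have /andP[S0 _] := S01 r x.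
  case: ifPn; first by rewrite -EFinB subr0.
  by rewrite -leNgt => S0'; congr EFin; apply/eqP; rewrite eq_le S0 S0'.
apply/seteqP; split => u /=; rewrite !in_itv/=.
  move=> [/quantile_lt[j]]; rewrite /g/=; case: ifPn => [uF qr|_ r1'].
    by move=> /andP[-> _]/=; apply: lt_le_trans uF _; exact: le_S.
  by have := lt_le_trans r1' r1; rewrite ltxx.
move=> /andP[u0]; move=> /sup_gt; case; first by eexists; exists 0%N.
move=> _ [j _ <-]; case: ifPn => [qr uF|_]; last first.
  by move=> /(le_lt_trans u0); rewrite ltxx.
split; last by rewrite u0 ltW// (lt_le_trans uF)//; case/andP: (F01 j x).
by apply/quantile_lt; exists j; rewrite /g/= uF.
Qed.

Let measurable_S r : (r <= 1)%R -> measurable_fun setT (S r).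
Proof.
move=> r1; apply/measurable_EFinP.
apply: (eq_measurable_fun (fun x => quantile_kernel x `]-oo, r[%classic)).
  by move=> x _; rewrite quantile_kernel_ray.
exact: measurable_kernel.
Qed.

(** Each [F j] with [q j < r] is almost surely below a density of the ray. Only countably many null
    sets are discarded, so the supremum is below it too. *)
Let integral_S_le r U : (r <= 1)%R -> measurable U ->
  \int[M]_(x in U) (S r x)%:E <= J (U `*` `]-oo, r[%classic).
Proof.
move=> r1 mU; have mr : measurable `]-oo, r[%classic by exact: measurable_itv.
have [D DJ] := exists_density J mr; have [mD D01 ->//] := DJ.
have FD : {ae M, forall x j, (q j < r)%R -> (F j x <= D x)%R}.
  apply: ae_foralln => j; have [qr|_] := boolP (q j < r)%R; last first.
    by apply: aeW.
  have : {ae M, forall x, (F j x <= D x)%R}.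
    apply: (le_density _ mr _ (F_density j) DJ); first exact: measurable_itv.
    by move=> y /=; rewrite !in_itv/= => /le_lt_trans; apply.
  by apply: filterS => x.
apply: ae_ge0_le_integral => //.
- by move=> x _; rewrite lee_fin; case/andP: (S01 r x).
- by apply: measurable_funTS; apply/measurable_EFinP; exact: measurable_S.
- by move=> x _; rewrite lee_fin; case/andP: (D01 x).
- by apply: measurable_funTS; exact/measurable_EFinP.
apply: filterS FD => x FD _; rewrite lee_fin.
apply: ge_sup; first by eexists; exists 0%N.
by move=> _ [j _ <-]; case: ifP => [|_]; [exact: FD|case/andP: (D01 x)].
Qed.

Let integral_S_ge r U : (r <= 1)%R -> measurable U ->
  J (U `*` `]-oo, r[%classic) <= \int[M]_(x in U) (S r x)%:E.
Proof.
move=> r1 mU.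
(* A finite union of closed rays is empty or one of these rays, so each [A n] is controlled by a
   single [F j]; continuity from below passes to the limit. *)
pose A n : set R := \big[setU/set0]_(j < n | (q j < r)%R) `]-oo, q j]%classic.
have AP n : A n = set0 \/ exists2 j, (q j < r)%R & A n = `]-oo, q j]%classic.
  rewrite /A; elim: n => [|n IHn]; first by left; rewrite big_ord0.
  rewrite big_mkcond big_ord_recr -big_mkcond/=.
  case: ifPn => [qn|_]; last by rewrite setU0.
  right; case: IHn => [->|[j jr ->]]; first by exists n => //; rewrite set0U.
  have [jn|nj] := leP (q j) (q n).
    exists n => //; apply/setUidPr => y /=; rewrite !in_itv/= => /le_trans; exact.
  exists j => //; apply/setUidPl => y /=; rewrite !in_itv/= => /le_trans; apply.
  exact: ltW.
have mA n : measurable (A n).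
  by case: (AP n) => [->//|[j _ ->]]; exact: measurable_itv.
have JA n : J (U `*` A n) <= \int[M]_(x in U) (S r x)%:E.
  case: (AP n) => [->|[j jr ->]].
    rewrite setX0 measure0; apply: integral_ge0 => x _; rewrite lee_fin.
    by case/andP: (S01 r x).
  have [mF _ ->//] := F_density j; apply: ge0_le_integral => //.
  - by move=> x _; rewrite lee_fin; case/andP: (F01 j x).
  - by apply: measurable_funTS; exact/measurable_EFinP.
  - by apply: measurable_funTS; apply/measurable_EFinP; exact: measurable_S.
  - by move=> x _; rewrite lee_fin; exact: le_S.
have ndA : nondecreasing_seq (fun n => U `*` A n).
  apply/nondecreasing_seqP => n; rewrite subsetEset => -[x y] /= [Ux Ay].
  by split => //; rewrite /A big_mkcond big_ord_recr -big_mkcond/=; left.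
have mUA n : measurable (U `*` A n) by exact: measurableX.
have cvJ := @nondecreasing_cvg_mu _ _ _ J _ mUA (bigcupT_measurable _ mUA) ndA.
have JUA : J (\bigcup_n (U `*` A n)) <= \int[M]_(x in U) (S r x)%:E.
  rewrite -(cvg_lim _ cvJ)//; apply: lime_le; first by apply/cvg_ex; eexists; exact: cvJ.
  exact: nearW.
have mI : measurable (~` `[0%R, 1%R]%classic : set R).
  by apply: measurableC; exact: measurable_itv.
have mN : measurable (setT `*` ~` `[0%R, 1%R]%classic : set (X * R)).
  exact: measurableX.
(* A point of the ray in [0, 1] is below some [q j < r] and so belongs to some [A n]; all other
   points fall into the null set of [J01]. *)
apply: le_trans JUA; apply: (@le_trans _ _
  (J ((\bigcup_n (U `*` A n)) `|` (setT `*` ~` `[0%R, 1%R]%classic)))).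
  apply: le_measure; rewrite ?inE//.
  - by apply: measurableX => //; exact: measurable_itv.
  - by apply: measurableU => //; exact: bigcupT_measurable.
  - move=> [x y] /= [Ux]; rewrite in_itv/= => yr.
    have [y01|y01] := pselect (`[0%R, 1%R]%classic y); last by right.
    left; move: y01; rewrite /= in_itv/= => /andP[y0 y1].
    have [j /andP[yj jr]] := q_dense y0 yr.
    exists j.+1 => //; split => //=; rewrite /A big_mkcond big_ord_recr/= jr.
    by right; rewrite /= in_itv/= ltW.
apply: le_trans (measureU2 _ _ _) _ => //; first exact: bigcupT_measurable.
by rewrite [X in _ + X]J01 adde0.
Qed.

Lemma disintegration_unit_interval : exists k : R.-pker X ~> R,
  forall U V, measurable U -> measurable V ->
    J (U `*` V) = \int[M]_(x in U) k x V.
Proof.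
exists quantile_kernel => U V mU mV; rewrite -semidirect_rectangle//.
apply: eq_probability_rays; last exact: measurableX.
move=> {}U r {}mU; have mr : measurable `]-oo, r[%classic by exact: measurable_itv.
rewrite [RHS]semidirect_rectangle//.
have [r1|r1] := leP r 1%R.
  rewrite (eq_integral (fun x => (S r x)%:E)); last first.
    by move=> x _; exact: quantile_kernel_ray.
  by apply/eqP; rewrite eq_le integral_S_le// integral_S_ge.
rewrite (eq_integral (cst 1)); last first.
  move=> x _; rewrite quantile_kernelE// (_ : [set _ | _] = setT).
    by rewrite setTI lebesgue_measure_itv/= lte_fin ltr01 oppr0 adde0.
  apply/seteqP; split => // u _ /=; rewrite in_itv/=; apply/quantile_lt.
  (* The threshold 0 contributes 0 or 1, both below [r], so for [r] above 1 the quantile always lies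
     in the ray. *)
  have [uF|uF] := ltP u (F (pickle (0 : rat)%R) x).
    exists (pickle (0 : rat)%R); rewrite /g/= uF /q pickleK/= rmorph0 normr0.
    exact: lt_trans r1.
  by exists (pickle (0 : rat)%R); rewrite /g/= (le_gtF uF).
rewrite integral_cst// mul1e [RHS](_ : _ = J (U `*` setT)); last first.
  by congr (J _); apply/seteqP; split=> -[x y] /=; [|case].
have mI : measurable (~` `[0%R, 1%R]%classic : set R).
  by apply: measurableC; exact: measurable_itv.
have mN : measurable (setT `*` ~` `[0%R, 1%R]%classic : set (X * R)).
  exact: measurableX.
apply/eqP; rewrite eq_le; apply/andP; split.
  apply: le_measure; rewrite ?inE//; [exact: measurableX|exact: measurableX|].
  by move=> z [].
apply: (@le_trans _ _ (J ((U `*` `]-oo, r[%classic) `|`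
    (setT `*` ~` `[0%R, 1%R]%classic)))).
  apply: le_measure; rewrite ?inE//.
  - exact: measurableX.
  - by apply: measurableU => //; exact: measurableX.
  - move=> [x y] /= [Ux _].
    have [y01|y01] := pselect (`[0%R, 1%R]%classic y); last by right.
    left; split => //; move: y01; rewrite /= !in_itv/= => /andP[_ y1].
    exact: le_lt_trans r1.
apply: le_trans (measureU2 _ _ _) _ => //; first exact: measurableX.
by rewrite [X in _ + X]J01 adde0.
Qed.

End disintegration_unit_interval.

Section kernel_map.
Context d d' d'' (X : measurableType d) (Y : measurableType d')
  (Z : measurableType d'') (R : realType).
Variables (k : R.-pker X ~> Y) (f : Y -> Z) (mf : measurable_fun setT f).

Definition kernel_map : R.-pker X ~> Z :=
  mixture k (kdirac (measurableT_comp mf (@measurable_snd _ _ X Y))).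

Lemma kernel_mapE x V : measurable V -> kernel_map x V = k x (f @^-1` V).
Proof.
move=> mV; have mfV : measurable (f @^-1` V).
  by rewrite -[X in measurable X]setTI; exact: mf.
rewrite /kernel_map/= /kcomp -[in RHS](setIT (f @^-1` V)) -integral_indic//.
Qed.

End kernel_map.

Lemma integral_fst_law d d' (X : measurableType d) (Y : measurableType d')
    (R : realType) (J : probability (X * Y)%type R) (U : set X) (f : X -> \bar R) :
  measurable U -> (forall x, 0 <= f x) -> measurable_fun setT f ->
  \int[fst_law J]_(x in U) f x = \int[J]_(z in U `*` setT) f z.1.
Proof.
move=> mU f0 mf; rewrite [LHS]integral_mkcond [RHS]integral_mkcond.
rewrite [RHS](_ : _ = \int[J]_z (f \_ U) z.1); last first.
  apply: eq_integral => -[x t] _; rewrite !patchE/=.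
  by congr (if _ then _ else _); apply/idP/idP; rewrite !inE//= => -[].
apply: ge0_integral_pushforward_eq => //.
- by move=> x; exact: erestrict_ge0.
- exact/(measurable_restrictT _ mU)/measurable_funTS.
Qed.

Section real_retract_kernels.
Context d d' (X : measurableType d) (T : measurableType d') (R : realType).
Hypothesis retT : real_retract R T.

(** [J] is pushed into the unit interval by [phi], disintegrated there, and the kernel is mapped
    back by [psi], which undoes [phi]. *)
Lemma disintegration (J : probability (X * T)%type R) :
  exists k : R.-pker X ~> T, is_cond_dist J k.
Proof.
have [phi [psi [mphi mpsi phiK phi01]]] := retT.
pose f (z : X * T) := (z.1, phi z.2).
have mf : measurable_fun setT f.
  by apply: measurable_fun_pair => //; exact: measurableT_comp.
pose fmix := isMeasurableFun.Build _ _ _ _ f mf.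
pose mff : {mfun (X * T)%type >-> (X * R)%type} := HB.pack f fmix.
pose J' := distribution J mff.
have [|k' k'E] := @disintegration_unit_interval _ _ _ J'.
  rewrite /J'/= /distribution/= /pushforward (_ : _ @^-1` _ = set0) ?measure0//.
  apply/seteqP; split => -[x t] //= [_]; rewrite /mkset in_itv/= => H.
  by apply: H; exact: phi01.
exists (kernel_map k' mpsi) => U V mU mV.
have mpsiV : measurable (psi @^-1` V).
  by rewrite -[X in measurable X]setTI; exact: mpsi.
transitivity (J' (U `*` (psi @^-1` V))).
  congr (J _); apply/seteqP; split => -[x t] /=; by rewrite phiK.
rewrite [LHS](k'E _ _ mU mpsiV) -(integral_fst_law _ mU (f := kernel_map k' mpsi ^~ V))//;
  last exact: measurable_kernel.
by apply: eq_integral => x _; rewrite kernel_mapE.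
Qed.

End real_retract_kernels.

(** * Almost sure uniqueness of kernels *)

Section kernel_uniqueness.
Context d d' (X : measurableType d) (T : measurableType d') (R : realType).

Let q (j : nat) : R := ratr (odflt 0%R (unpickle j)).

Let measurable_rational_rays :
  @measurable _ R = <<s range (fun j => `]-oo, q j[%classic) >>.
Proof.
transitivity <<s @RGenInftyO.G R >>; first exact: RGenInftyO.measurableE.
rewrite eqEsubset; split; last first.
  apply: smallest_sub; first exact: smallest_sigma_algebra.
  by move=> _ [j _ <-]; apply: sub_sigma_algebra; exists (q j).
apply: smallest_sub; first exact: smallest_sigma_algebra.
move=> _ [r ->].
pose C := g_sigma_algebraType (range (fun j => `]-oo, q j[%classic)).
have -> : `]-oo, r[%classic =
    \bigcup_j (if (q j < r)%R then `]-oo, q j[%classic else set0).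
  apply/seteqP; split => x /=; last first.
    move=> [j _]; case: ifPn => // qr; rewrite /= !in_itv/= => xq.
    exact: lt_trans qr.
  rewrite in_itv/= => /rat_in_itvoo[p]; rewrite in_itv/= => /andP[xp pr].
  by exists (pickle p) => //; rewrite /q pickleK/= pr /= in_itv.
apply: (@bigcupT_measurable _ C) => j; case: ifPn => _; last exact: measurable0.
by apply: sub_sigma_algebra; exists j.
Qed.

Lemma eq_probability_rational_rays (m1 m2 : {measure set R -> \bar R}) :
  m1 setT = 1 ->
  (forall j, m1 `]-oo, q j[%classic = m2 `]-oo, q j[%classic) ->
  forall V, measurable V -> m1 V = m2 V.
Proof.
move=> m1T m12 V mV.
have mray j : measurable `]-oo, q j[%classic by exact: measurable_itv.
apply: (@measure_unique _ R _ _ (fun n => `]-oo, q (pickle (n%:R : rat))[%classic)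
  measurable_rational_rays _ _ _ m1 m2) => //.
- move=> _ _ [i _ <-] [j _ <-]; have [ij|ji] := leP (q i) (q j).
    exists i => //; apply/esym/setIidPl => x /=; rewrite !in_itv/=.
    by move=> /lt_le_trans; exact.
  exists j => //; apply/esym/setIidPr => x /=; rewrite !in_itv/=.
  by move=> /lt_trans; exact.
- apply/seteqP; split => // x _; exists (Num.truncn x).+1 => //=.
  by rewrite in_itv/= /q pickleK/= ratr_nat truncnS_gt.
- by move=> _ [j _ <-]; exact: m12.
- move=> n; apply: (@le_lt_trans _ _ (m1 setT)); last by rewrite m1T ltry.
  by apply: le_measure; rewrite ?inE.
Qed.

(** On the pullback of each rational ray the kernels agree off a null set. Off the union of these
    countably many sets the two laws agree on a generating family, hence on all [V] at once. *)
Lemma ae_eq_kernel (retT : real_retract R T) (M : probability X R)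
    (k1 k2 : R.-pker X ~> T) :
  (forall U V, measurable U -> measurable V ->
    \int[M]_(x in U) k1 x V = \int[M]_(x in U) k2 x V) ->
  {ae M, forall x V, measurable V -> k1 x V = k2 x V}.
Proof.
have [phi [psi [mphi mpsi phiK _]]] := retT => k12.
have mV j : measurable (phi @^-1` `]-oo, q j[%classic).
  by rewrite -[X in measurable X]setTI; exact: (mphi measurableT _ (measurable_itv _)).
have : {ae M, forall x j,
    k1 x (phi @^-1` `]-oo, q j[%classic) = k2 x (phi @^-1` `]-oo, q j[%classic)}.
  apply: ae_foralln => j; apply: ge0_integral_ae_eq => //.
  - exact: measurable_kernel.
  - exact: measurable_kernel.
  - apply: (@le_lt_trans _ _ (\int[M]_x cst 1 x)).
      apply: ge0_le_integral => //; first exact: measurable_kernel.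
      by move=> x _; rewrite -(@prob_kernel _ _ _ _ _ k1 x); apply: le_measure;
        rewrite ?inE.
    by rewrite integral_cst// mul1e -ge0_fin_numE// fin_num_measure.
  - by move=> U mU; exact: k12.
apply: filterS => x k12x V mV'.
have mpsiV : measurable (psi @^-1` V).
  by rewrite -[X in measurable X]setTI; exact: mpsi.
have -> : V = phi @^-1` (psi @^-1` V).
  by apply/seteqP; split => t /=; rewrite phiK.
rewrite -(kernel_mapE k1 mphi)// -(kernel_mapE k2 mphi)//.
apply: eq_probability_rational_rays => //; first exact: prob_kernel.
move=> j; rewrite !kernel_mapE//; exact: measurable_itv.
Qed.

End kernel_uniqueness.

(** * Relative entropy depends only on values on measurable sets *)

Section relative_entropy_eq.
Context d (T : measurableType d) (R : realType).
Variables p p' q q' : probability T R.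
Hypothesis pp' : forall V, measurable V -> p V = p' V.
Hypothesis qq' : forall V, measurable V -> q V = q' V.

(** [Radon_Nikodym] is a chosen density, so the two pairs may receive different ones. The choices
    agree [q]-almost surely, and by domination also [p]-almost surely. *)
Lemma eq_relative_entropy : relative_entropy p q = relative_entropy p' q'.
Proof.
rewrite /relative_entropy.
have pq_p'q' : p `<< q -> p' `<< q'.
  move=> /null_content_dominatesP pq; apply/null_content_dominatesP => V mV q'V.
  by rewrite -[LHS]pp'//; apply: pq => //; rewrite [LHS]qq'.
have p'q'_pq : p' `<< q' -> p `<< q.
  move=> /null_content_dominatesP pq; apply/null_content_dominatesP => V mV qV.
  by rewrite [LHS]pp'//; apply: pq => //; rewrite -[LHS]qq'.
case: asboolP => pq; case: asboolP => p'q' //; last 2 first.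
- by case: p'q'; exact: pq_p'q'.
- by case: pq; exact: p'q'_pq.
rewrite (@eq_measure_integral _ _ _ setT p'); last first.
  by move=> V mV _; exact: pp'.
apply: ae_eq_lower_integral.
set f := Radon_Nikodym _ _; set g := Radon_Nikodym _ _.
have : ae_eq q setT f g.
  have intg : q'.-integrable setT g by exact: Radon_Nikodym_integrable.
  apply: integral_ae_eq => //.
  - exact: Radon_Nikodym_integrable.
  - exact: measurable_int intg.
  - move=> E _ mE; rewrite -Radon_Nikodym_integral//.
    rewrite (@eq_measure_integral _ _ _ E q'); last by move=> V mV _; exact: qq'.
    by rewrite -Radon_Nikodym_integral//; exact: pp'.
move=> [N [mN qN0 Nfg]]; exists N; split => //.
  rewrite -[LHS]pp'//; move/null_content_dominatesP: pq; exact.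
by move=> x /= fg; apply: Nfg => /= fgx; apply: fg; rewrite fgx.
Qed.

End relative_entropy_eq.

Section conditional_distribution_semidirect.
Import HBNNSimple.
Context d d' (X : measurableType d) (Y : measurableType d') (R : realType).
Implicit Types (J : probability (X * Y)%type R) (k : R.-pker X ~> Y).

Lemma is_cond_distP J k : is_cond_dist J k <->
  forall E, measurable E -> J E = semidirect (fst_law J) k E.
Proof.
split=> [Jk|Jk U V mU mV].
  apply: eq_probability_rectangles => U V mU mV.
  rewrite Jk// [RHS]semidirect_rectangle// (integral_fst_law _ mU (f := k ^~ V))//.
  exact: measurable_kernel.
rewrite Jk; last exact: measurableX.
rewrite [LHS]semidirect_rectangle// (integral_fst_law _ mU (f := k ^~ V))//.
exact: measurable_kernel.
Qed.

Lemma cond_distP J : (exists k, is_cond_dist J k) -> is_cond_dist J (cond_dist J).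
Proof. by move=> Jk; rewrite /cond_dist; case: pselect => // ?; case: cid. Qed.

Lemma eq_semidirect (m1 m2 : probability X R) k :
  (forall U, measurable U -> m1 U = m2 U) ->
  forall E, measurable E -> semidirect m1 k E = semidirect m2 k E.
Proof. by move=> m12 E mE; apply: eq_measure_integral => U mU _; exact: m12. Qed.

Lemma semidirect_cond_dist (m : probability X R) k J :
  (forall E, measurable E -> J E = semidirect m k E) -> is_cond_dist J k.
Proof.
move=> Jmk; apply/is_cond_distP => E mE; rewrite Jmk//; apply: eq_semidirect => // U mU.
rewrite [RHS]fst_lawE Jmk; last exact: measurableX.
by rewrite [RHS]semidirect_fst.
Qed.

Lemma ae_semidirect (m : probability X R) k (P : X -> Prop) :
  {ae m, forall x, P x} -> {ae semidirect m k, forall z, P z.1}.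
Proof.
move=> [N [mN N0 NP]]; exists (N `*` setT); split.
- exact: measurableX.
- by rewrite [LHS]semidirect_fst.
- by move=> z /= nP; split => //; exact: NP.
Qed.

(* Holds for every integrand, measurable or not: integrating the simple
   functions below [f \o fst] over the fibres gives measurable functions
   below [f]. *)
Lemma lower_integral_fst J (f : X -> \bar R) : real_retract R Y ->
  \int[fst_law J]_x f x = \int[J]_z f z.1.
Proof.
move=> retY; have [k /is_cond_distP Jk] := disintegration retY J.
apply: lower_integral_split => {}f f0; apply/eqP; rewrite eq_le; apply/andP; split.
  by apply: ge0_lower_integral_pushforward_le => //; exact: measurable_fst.
apply: ge0_lower_integral_le => // h hf.
rewrite (@eq_measure_integral _ _ _ setT (semidirect (fst_law J) k)); last first.
  by move=> E mE _; exact: Jk.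
rewrite ge0_integral_semidirect//; last 2 first.
- by move=> z; rewrite lee_fin.
- exact/measurable_EFinP.
apply: ge0_le_lower_integral => x.
  by apply: integral_ge0 => y _; rewrite lee_fin.
apply: (@le_trans _ _ (\int[k x]_y (cst (f x) y))).
  by apply: ge0_le_lower_integral => y; [rewrite lee_fin|exact: hf].
by rewrite integral_cst// prob_kernel mule1.
Qed.

End conditional_distribution_semidirect.

(** * Output feedback versions of input kernels *)

Section second_coordinate_law.
Context d d' (X : measurableType d) (Y : measurableType d') (R : realType).

Definition snd_law (J : probability (X * Y)%type R) : probability Y R :=
  distribution J (@second _ _ X Y).

End second_coordinate_law.

Definition last_input (X Y Z : Type) (z : (X * Y) * Z) : Z * Y := (z.2, z.1.2).

Lemma measurable_last_input d d' d'' (X : measurableType d)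
    (Y : measurableType d') (Z : measurableType d'') :
  measurable_fun setT (@last_input X Y Z).
Proof. by apply: measurable_fun_pair => //; exact: measurableT_comp. Qed.

HB.instance Definition _ d d' d'' (X : measurableType d)
    (Y : measurableType d') (Z : measurableType d'') :=
  isMeasurableFun.Build _ _ ((X * Y) * Z)%type (Z * Y)%type (@last_input X Y Z)
    (@measurable_last_input _ _ _ X Y Z).

Lemma lower_integral_swap d d' (X : measurableType d) (Y : measurableType d')
    (R : realType) (J : probability (X * Y)%type R) (f : Y * X -> \bar R) :
  \int[swap_law J]_z f z = \int[J]_z f (z.2, z.1).
Proof.
apply: (@lower_integral_iso _ _ _ _ _ J (swap_law J)
  (@swap_pair X Y) (@swap_pair Y X)) => //; by case.
Qed.

Lemma lower_integral_assoc_right d d' d'' (X : measurableType d)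
    (Y : measurableType d') (Z : measurableType d'') (R : realType)
    (J : probability ((X * Y) * Z)%type R) (f : X * (Y * Z) -> \bar R) :
  \int[distribution J (@assoc_right _ _ _ X Y Z)]_z f z =
  \int[J]_z f (z.1.1, (z.1.2, z.2)).
Proof.
apply: (@lower_integral_iso _ _ _ _ _ J (distribution J (@assoc_right _ _ _ X Y Z))
  (@assoc_right _ _ _ X Y Z) (fun w => ((w.1, w.2.1), w.2.2))) => //.
- apply: measurable_fun_pair; last exact: measurableT_comp.
  by apply: measurable_fun_pair => //; exact: measurableT_comp.
- by move=> [[]].
- by move=> [? []].
Qed.

Section projections.
Context (R : realType) (A : nat -> ptopologicalType).
Hypothesis retA : forall i, real_retract R (borel (A i)).

(* The integrand need not be measurable, so this is not a mere change of
   variables: the inputs are integrated out one at a time. *)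
Lemma lower_integral_in_hist i d (X : measurableType d)
    (J : probability (in_hist A i * X)%type R) (f : X -> \bar R) :
  \int[snd_law J]_x f x = \int[J]_z f z.2.
Proof.
elim: i d X J f => [|i IHi] d X J f.
  apply: (@lower_integral_iso _ _ _ _ _ J (snd_law J) snd (fun x => (tt, x))) => //.
  - exact: measurable_fun_pair.
  - by move=> [[] x].
(* [J1] groups the last input with [X]. The induction hypothesis removes the earlier inputs; after a
   swap the last one is the second coordinate, which [lower_integral_fst] removes. *)
pose J1 := distribution J (@assoc_right _ _ _ (in_hist A i) (borel (A i)) X).
pose J2 := swap_law (snd_law J1).
rewrite (@eq_measure_integral _ _ _ setT (fst_law J2)); last first.
  by move=> U mU _; congr (J _).
rewrite (lower_integral_fst J2 f (retA i)) lower_integral_swap.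
by rewrite (IHi _ _ J1 (fun v => f v.2)) lower_integral_assoc_right.
Qed.

Lemma lower_integral_last_input i d (X : measurableType d)
    (J : probability (in_hist A i.+1 * X)%type R) (f : X * borel (A i) -> \bar R) :
  \int[distribution J (@last_input _ _ _)]_w f w = \int[J]_z f (z.2, z.1.2).
Proof.
pose J1 := distribution J (@assoc_right _ _ _ (in_hist A i) (borel (A i)) X).
rewrite (@eq_measure_integral _ _ _ setT (swap_law (snd_law J1))); last first.
  by move=> U mU _; congr (J _).
rewrite lower_integral_swap (lower_integral_in_hist J1 (fun v => f (v.2, v.1))).
by rewrite lower_integral_assoc_right.
Qed.

End projections.

Section feedback_version.
Context (R : realType) (A : nat -> ptopologicalType) (B : int -> ptopologicalType).
Hypothesis retA : forall i, real_retract R (borel (A i)).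
Hypothesis retB : forall i : nat, real_retract R (borel (B (Posz i))).
Variables (n : nat) (mu : probability (out_hist B 0) R).
Variables (W : @channel R A B) (Q : @channel_A R A B).
Hypothesis WQ : class_A n W Q.
Implicit Types (P : @input_kernels R A B) (pi : @output_feedback_kernels R A B).

(* the joint law of (B^{i-1}, A_i) *)
Definition output_input_law P i :
    probability (out_hist B i * borel (A i))%type R :=
  distribution (input_law mu W P i) (@last_input _ _ _).

(** A relation between [P] and [pi]: the laws and values below depend on [pi] alone, so input
    kernels sharing a version are interchangeable. *)
Definition feedback_version P pi :=
  forall i, (i <= n)%N -> is_cond_dist (output_input_law P i) (pi i).

Lemma exists_feedback_version P : exists pi, feedback_version P pi.
Proof.
exists (fun i => sval (cid (disintegration (retA i) (output_input_law P i)))).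
by move=> i _; case: cid.
Qed.

Lemma fst_output_input_law P i U : measurable U ->
  fst_law (output_input_law P i) U = snd_law (history_law mu W P i) U.
Proof.
move=> mU; rewrite [RHS](_ : _ = history_law mu W P i (setT `*` U)); last first.
  by congr (history_law _ _ _ _ _); apply/seteqP; split=> -[x y] //= [].
rewrite -(semidirect_fst _ (P i)); last exact: measurableX.
by congr (semidirect _ _ _); apply/seteqP; split=> -[[x y] z] //= [] // [].
Qed.

Lemma output_input_law_feedback pi i U V : measurable U -> measurable V ->
  output_input_law (input_of_feedback pi) i (U `*` V) =
  \int[snd_law (history_law mu W (input_of_feedback pi) i)]_(b in U) pi i b V.
Proof.
move=> mU mV; set P := input_of_feedback pi.
transitivity (semidirect (history_law mu W P i) (P i) ((setT `*` U) `*` V)).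
  by congr (semidirect _ _ _); apply/seteqP; split=> -[[x y] z] //= [] // [].
rewrite semidirect_rectangle//; last exact: measurableX.
rewrite [LHS]integral_mkcond [RHS]integral_mkcond.
rewrite [RHS](@ge0_integral_pushforward_eq _ _ _ _ _ (history_law mu W P i)
  (snd_law (history_law mu W P i)) (@second _ _ _ _)) => //.
- apply: eq_integral => -[x y] _; rewrite !patchE/=.
  by congr (if _ then _ else _); apply/idP/idP; rewrite !inE//= => -[].
- by move=> b; apply: erestrict_ge0 => y _; exact: measure_ge0.
- apply/(measurable_restrictT _ mU)/measurable_funTS; exact: measurable_kernel.
Qed.

Lemma feedback_version_input_of_feedback pi :
  feedback_version (input_of_feedback pi) pi.
Proof.
move=> i _ U V mU mV; rewrite output_input_law_feedback//.
rewrite -(integral_fst_law _ mU (f := pi i ^~ V))//;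
  last exact: measurable_kernel.
apply: eq_measure_integral => E mE _; exact/esym/fst_output_input_law.
Qed.

(** By class A the channel sees only the past outputs and the last input, so the earlier inputs
    integrate out. *)
Lemma output_lawS P i E : (i <= n)%N -> measurable E ->
  snd_law (history_law mu W P i.+1) E =
  \int[output_input_law P i]_w Q i w (xsection E w.1).
Proof.
move=> ni mE; rewrite lower_integral_last_input//.
apply: eq_integral => -[[h a] b] _ /=.
have mEb : measurable (xsection E b) by exact: measurable_xsection.
rewrite -[RHS](WQ ni (h, a) b mEb).
by congr (W i _ _); apply/seteqP; split=> y; rewrite /xsection/= !inE.
Qed.

Lemma output_law_feedbackS pi i E : measurable E ->
  output_law mu Q pi i.+1 E =
  \int[semidirect (output_law mu Q pi i) (pi i)]_w Q i w (xsection E w.1).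
Proof.
move=> mE; rewrite ge0_integral_semidirect//.
pose E' : set ((out_hist B i * borel (A i)) * borel (B (Posz i))) :=
  [set z | E (z.1.1, z.2)].
have mE' : measurable E'.
  rewrite -[X in measurable X]setTI.
  have mf : measurable_fun setT (fun z : (out_hist B i * borel (A i)) *
      borel (B (Posz i)) => (z.1.1, z.2)).
    by apply: measurable_fun_pair => //; exact: measurableT_comp.
  exact: mf.
rewrite (_ : (fun _ => _) = (fun w => Q i w (xsection E' w))).
  by apply: measurable_fun_xsection_finite_kernel; rewrite inE.
by apply/funext => w; congr (Q i w _).
Qed.

(** The channel produces the next output law from that of (B^{i-1}, A_i), which is the law of
    B^{i-1} followed by [pi i]. The range reaches [n.+1] because [output_cond] at time [n]
    conditions within the law of B^n. *)
Lemma feedback_version_laws P pi : feedback_version P pi ->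
  forall i, (i <= n.+1)%N -> forall E, measurable E ->
    snd_law (history_law mu W P i) E = output_law mu Q pi i E.
Proof.
move=> Ppi; elim=> [_ E mE|i IHi ni E mE].
  by congr (mu _).
rewrite output_lawS// output_law_feedbackS//; apply: eq_measure_integral => F mF _.
have /is_cond_distP Jk := Ppi i ni; rewrite [LHS]Jk//.
apply: eq_semidirect => // U mU; rewrite [LHS]fst_output_input_law//.
by apply: IHi => //; exact: ltnW.
Qed.

Lemma feedback_version_output_input_law P pi : feedback_version P pi ->
  forall i, (i <= n)%N -> forall E, measurable E ->
    output_input_law P i E = semidirect (output_law mu Q pi i) (pi i) E.
Proof.
move=> Ppi i ni E mE; have /is_cond_distP Jk := Ppi i ni; rewrite [LHS]Jk//.
apply: eq_semidirect => // U mU; rewrite [LHS]fst_output_input_law//.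
by rewrite (feedback_version_laws Ppi)// ltnW.
Qed.

Lemma ae_output_cond P pi i : feedback_version P pi -> (i <= n)%N ->
  {ae output_law mu Q pi i, forall b V, measurable V ->
    output_cond mu W P i b V = output_kernel Q pi i b V}.
Proof.
move=> Ppi ni; apply: ae_eq_kernel => // U V mU mV.
pose J := snd_law (history_law mu W P i.+1).
have JE E : measurable E ->
    J E = semidirect (output_law mu Q pi i) (output_kernel Q pi i) E.
  by move=> mE; exact: (feedback_version_laws Ppi).
have Jk := semidirect_cond_dist JE.
(* [output_kernel] witnesses existence, so [cond_dist] is a true conditional distribution and not
   its placeholder. *)
have Jc : is_cond_dist J (output_cond mu W P i).
  by apply: cond_distP; exists (output_kernel Q pi i).
have fstJ F : measurable F -> output_law mu Q pi i F = fst_law J F.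
  move=> mF; rewrite [RHS]fst_lawE JE; last exact: measurableX.
  by rewrite semidirect_fst.
rewrite [LHS](@eq_measure_integral _ _ _ _ (fst_law J));
  last by move=> F mF _; exact: fstJ.
rewrite [RHS](@eq_measure_integral _ _ _ _ (fst_law J));
  last by move=> F mF _; exact: fstJ.
rewrite (integral_fst_law _ mU (f := output_cond mu W P i ^~ V))//;
  last exact: measurable_kernel.
rewrite (integral_fst_law _ mU (f := output_kernel Q pi i ^~ V))//;
  last exact: measurable_kernel.
by rewrite -Jc// -Jk.
Qed.

Lemma feedback_version_directed_info P pi : feedback_version P pi ->
  directed_info mu W P n = feedback_info mu Q pi n.
Proof.
move=> Ppi; apply: eq_bigr => -[i /= ni] _; rewrite ltnS in ni.
pose F w := relative_entropy (kernel_at (Q i) w) (kernel_at (output_cond mu W P i) w.1).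
transitivity (\int[input_law mu W P i]_z F (z.2, z.1.2)).
  apply: eq_integral => -[[h a] b] _ /=; apply: eq_relative_entropy => //.
  by move=> V mV; exact: WQ.
(* The integrand involves only the outputs and the last input but is not known to be measurable,
   hence the projection formula for lower integrals. *)
rewrite -(lower_integral_last_input retA (input_law mu W P i)).
rewrite (@eq_measure_integral _ _ _ _
  (semidirect (output_law mu Q pi i) (pi i))); last first.
  by move=> E mE _; exact: (feedback_version_output_input_law Ppi).
apply: ae_eq_lower_integral.
have := ae_semidirect (pi i) (ae_output_cond Ppi ni).
by apply: filterS => w H; exact: eq_relative_entropy.
Qed.

Lemma directed_info_class_A P : directed_info mu W P n = directed_info_A mu W P n Q.
Proof.
apply: eq_bigr => -[i /= ni] _; rewrite ltnS in ni.
apply: eq_integral => -[[h a] b] _ /=; apply: eq_relative_entropy => //.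
by move=> V mV; exact: WQ.
Qed.

Lemma input_of_feedback_depends_on_outputs_only pi :
  depends_on_outputs_only mu W (input_of_feedback pi) n.
Proof. by exists pi => i _; apply: aeW. Qed.

End feedback_version.

(** * Transmission costs *)

Lemma ae_pushforward d d' (X : measurableType d) (Y : measurableType d')
    (R : realType) (m : {measure set X -> \bar R}) (m' : {measure set Y -> \bar R})
    (phi : X -> Y) (P : Y -> Prop) : measurable_fun setT phi ->
  (forall V, measurable V -> m' V = m (phi @^-1` V)) ->
  {ae m', forall y, P y} -> {ae m, forall x, P (phi x)}.
Proof.
move=> mphi m'E [N [mN N0 NP]]; exists (phi @^-1` N); split.
- by rewrite -[X in measurable X]setTI; exact: mphi.
- by rewrite -m'E.
- by move=> x /= nP; exact: NP.
Qed.

(* [m] is the essential infimum of [g (_, x)] under [k x]; the plain infimum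
   need not be measurable. *)
Lemma exists_conditional_essinf d d' (X : measurableType d) (T : measurableType d')
    (R : realType) (k : R.-pker X ~> T) (g : T * X -> R) :
  measurable_fun setT g -> (forall x, exists L, forall t, (L <= g (t, x))%R) ->
  exists m : X -> R, [/\ measurable_fun setT m,
    forall x (e : R), (0 < e)%R -> exists t, (g (t, x) < m x + e)%R &
    forall mu : probability X R,
      {ae semidirect mu k, forall w, (m w.1 <= g (w.2, w.1))%R}].
Proof.
move=> mg lbg.
pose q (j : nat) : R := ratr (odflt 0%R (unpickle j)).
have qP (r s : R) : (r < s)%R -> exists j, (r < q j < s)%R.
  move=> /rat_in_itvoo[p]; rewrite in_itv/= => rps.
  by exists (pickle p); rewrite /q pickleK.
pose E j : set (X * T) := [set w | (g (w.2, w.1) < q j)%R].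
have mE j : measurable (E j).
  have mg' : measurable_fun setT (fun w : X * T => g (w.2, w.1)).
    by apply: measurableT_comp => //; exact: measurable_swap_pair.
  rewrite (_ : E j = (fun w => g (w.2, w.1)) @^-1` `]-oo, q j[%classic).
    by rewrite -[X in measurable X]setTI; exact: (mg' measurableT _ (measurable_itv _)).
  by apply/seteqP; split => w; rewrite /E/= in_itv.
pose N j x := k x (xsection (E j) x).
have NE j x : N j x = k x [set t | (g (t, x) < q j)%R].
  by congr (k x _); apply/seteqP; split=> t; rewrite /xsection/= inE.
have mset j x : measurable [set t | (g (t, x) < q j)%R].
  rewrite (_ : [set _ | _] = xsection (E j) x); first exact: measurable_xsection.
  by apply/seteqP; split=> t; rewrite /xsection/= inE.
have mN j : measurable_fun setT (N j).
  by apply: measurable_fun_xsection_finite_kernel; rewrite inE.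
have mN0 j : measurable [set x | N j x = 0].
  rewrite (_ : [set _ | _] = N j @^-1` [set 0])//.
  by rewrite -[X in measurable X]setTI; exact: mN.
(* A threshold counts when [g (_, x)] is almost surely not below it; the supremum of those that
   count is the essential infimum. *)
pose l j x : \bar R := if N j x == 0 then (q j)%:E else -oo.
have ml j : measurable_fun setT (l j).
  apply: measurable_fun_ifT => //; apply: (measurable_fun_bool true) => //.
  by rewrite setTI (_ : _ @^-1` _ = [set x | N j x = 0])//; apply/seteqP;
    split=> x /= /eqP.
pose s x := esups (l ^~ x) 0%N.
have ls j x : l j x <= s x by apply: ereal_sup_ubound; exists j.
have s_le x y : (forall j, l j x <= y) -> s x <= y.
  by move=> H; apply: ge_ereal_sup => _ [j _ <-].
(* Thresholds under a lower bound of [g (_, x)] count, so [s x] is not -oo. The sublevel sets cover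
   a space of mass 1, so one of them has positive mass, and its threshold bounds [s x] from
   above. *)
have s_fin x : s x \is a fin_num.
  rewrite fin_numE; apply/andP; split; apply/eqP => sx.
    have [L HL] := lbg x; have L1 : (L - 1 < L)%R by lra.
    have [j /andP[_ jL]] := qP _ _ L1.
    have := ls j x; rewrite sx /l NE (_ : [set _ | _] = set0) ?measure0 ?eqxx//.
    apply/seteqP; split => t //= gq.
    by have := lt_le_trans (lt_trans gq jL) (HL t); rewrite ltxx.
  have [j0 Nj0] : exists j, N j x <> 0.
    apply: contrapT => nN.
    have : (k x).-negligible (\bigcup_j [set t | (g (t, x) < q j)%R]).
      apply: negligible_bigcup => j; apply/negligibleP => //; rewrite -[LHS]NE.
      by apply: contrapT => H; apply: nN; exists j.
    rewrite (_ : \bigcup_j _ = setT).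
      move/negligibleP => /(_ measurableT) kx0.
      have := @prob_kernel _ _ _ _ _ k x; rewrite [LHS]kx0 => -[].
      by move=> /esym/eqP; rewrite oner_eq0.
    apply/seteqP; split => // t _.
    have [j /andP[gq _]] := qP (g (t, x)) (g (t, x) + 1)%R ltac:(lra).
    by exists j.
  suff : s x <= (q j0)%:E by rewrite sx.
  apply: s_le => j; rewrite /l; case: eqP => [Nj|_]; last exact: leNye.
  rewrite lee_fin leNgt; apply/negP => jj; apply: Nj0.
  apply/eqP; rewrite -measure_le0 -Nj; apply: le_measure; rewrite ?inE;
    [exact: measurable_xsection|exact: measurable_xsection|].
  by move=> t; rewrite /xsection/= !inE => gq; exact: lt_trans jj.
exists (fun x => fine (s x)); split.
- by apply: measurableT_comp => //; exact: measurable_fun_esups.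
(* Otherwise a threshold strictly between [m x] and [m x + e] would have an empty sublevel set,
   would count, and so would be at most [m x]. *)
- move=> x e e0; apply: contrapT => nt.
  have [j /andP[sj je]] : exists j, (fine (s x) < q j < fine (s x) + e)%R.
    by apply: qP; rewrite ltrDl.
  have := ls j x; rewrite /l NE (_ : [set _ | _] = set0) ?measure0 ?eqxx.
    by rewrite -(fineK (s_fin x)) lee_fin leNgt sj.
  apply/seteqP; split => t //= gq; apply: nt; exists t; exact: lt_trans je.
- move=> mu.
  have : {ae semidirect mu k, forall w j, N j w.1 = 0 -> (q j <= g (w.2, w.1))%R}.
    apply: ae_foralln => j.
    (* Every section of this set is null under [k x]: where [N j x = 0] its mass is [N j x],
       elsewhere it is empty. It is therefore null for every [mu]. *)
    exists (E j `&` ([set x | N j x = 0] `*` setT)); split.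
    + by apply: measurableI => //; exact: measurableX.
    + rewrite [LHS](eq_integral (cst 0)) ?integral0// => x _ /=.
      have [Nx|Nx] := pselect (N j x = 0).
        rewrite -[RHS]Nx; congr (k x _).
        apply/seteqP; split=> t; rewrite /xsection/= !inE.
          by case.
        by [].
      rewrite [X in k x X](_ : _ = set0) ?measure0//.
      by apply/seteqP; split=> t //=; rewrite /xsection/= inE => -[_ []].
    + move=> [x t] /= /not_implyP[Nx] /negP; rewrite -ltNge => gq.
      by split.
  apply: filterS => w Hw; rewrite -lee_fin fineK//; apply: s_le => j.
  by rewrite /l; case: eqP => [/Hw|_]; [rewrite lee_fin|rewrite leNye].
Qed.

(** * Pathwise decomposition of the cost *)

Section sum_costs.
Context (R : realType) (A : nat -> ptopologicalType) (B : int -> ptopologicalType).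
Implicit Types gamma : forall i : nat, borel (A i) * out_hist B i -> R.

Lemma measurable_drop_last d1 d2 d3 d4 (X : measurableType d1)
    (Y : measurableType d2) (Z : measurableType d3) (T : measurableType d4) :
  measurable_fun setT (fun z : (X * Y) * (Z * T) => (z.1.1, z.2.1)).
Proof. by apply: measurable_fun_pair; exact: measurableT_comp. Qed.

Lemma measurable_input_output d1 d2 d3 (X : measurableType d1)
    (Y : measurableType d2) (Z : measurableType d3) :
  measurable_fun setT (fun z : (X * Y) * Z => (z.1.2, z.2)).
Proof. by apply: measurable_fun_pair => //; exact: measurableT_comp. Qed.

Lemma measurable_sum_costs gamma n :
  (forall i, (i <= n)%N -> measurable_fun setT (gamma i)) ->
  measurable_fun setT (@sum_costs R A B gamma n).
Proof.
elim: n => [|n IHn] mgamma /=.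
  by apply: measurableT_comp; [exact: mgamma|exact: measurable_input_output].
apply: measurable_funD.
  have mn : measurable_fun setT (@sum_costs R A B gamma n).
    by apply: IHn => i ni; apply: mgamma; exact: leqW.
  exact: (measurableT_comp mn (@measurable_drop_last _ _ _ _
    (in_hist A n.+1) (borel (A n.+1)) (out_hist B n) (borel (B (Posz n))))).
by apply: measurableT_comp; [exact: mgamma|exact: measurable_input_output].
Qed.

Lemma sum_costs_ge0 gamma n z : (forall i w, (0 <= gamma i w)%R) ->
  (0 <= @sum_costs R A B gamma n z)%R.
Proof.
by move=> gamma0; elim: n z => [|n IHn] z /=; [exact: gamma0|rewrite addr_ge0].
Qed.

(** Freezing the other inputs bounds one summand through the sum. The bound [h] varies with the
    outputs so that the induction can absorb the last summand, evaluated at [point]. *)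
Lemma sum_costs_lower_bound gamma n (h : out_hist B n -> R) :
  (forall z, (- h z.2 <= @sum_costs R A B gamma n z)%R) ->
  forall i, (i <= n)%N -> forall b, exists L, forall a, (L <= gamma i (a, b))%R.
Proof.
elim: n h => [|n IHn] h hgamma i.
  rewrite leqn0 => /eqP -> b; exists (- h b)%R => a.
  exact: hgamma ((tt, a), b).
rewrite leq_eqVlt => /predU1P[-> b|ni]; last first.
  apply: (IHn (fun b => h (b, point) + gamma n.+1 (point, (b, point)))%R) => // z.
  by have := hgamma ((z.1, point), (z.2, point)) => /=; case: z => ? ? /=; lra.
pose z : in_hist A n.+1 * out_hist B n := (point, b.1).
exists (- h b - @sum_costs R A B gamma n z)%R => a.
by have := hgamma ((point, a), b) => /=; rewrite /z; lra.
Qed.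

Fixpoint sum_outputs (m : forall i : nat, out_hist B i -> R) (n : nat) :
    out_hist B n -> R :=
  match n with
  | 0 => fun b => m 0%N b
  | j.+1 => fun b => (sum_outputs m b.1 + m j.+1 b)%R
  end.

Lemma measurable_sum_outputs (m : forall i : nat, out_hist B i -> R) n :
  (forall i, (i <= n)%N -> measurable_fun setT (m i)) ->
  measurable_fun setT (@sum_outputs m n).
Proof.
elim: n => [|n IHn] mm; first exact: mm.
apply: (@measurable_funD _ (out_hist B n.+1) R setT
  (fun b => sum_outputs m b.1) (m n.+1)); last exact: mm.
have mn : measurable_fun setT (@sum_outputs m n).
  by apply: IHn => i ni; apply: mm; exact: leqW.
exact: (measurableT_comp mn (@measurable_fst _ _ (out_hist B n) (borel (B (Posz n))))).
Qed.

Lemma sum_costs_split gamma (m : forall i : nat, out_hist B i -> R) n z :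
  (@sum_costs R A B gamma n z =
  sum_costs (fun i w => gamma i w - m i w.2) z + sum_outputs m z.2)%R.
Proof.
elim: n z => [|n IHn] z /=; first by rewrite subrK.
by rewrite IHn/=; lra.
Qed.

(** For fixed outputs the inputs can be chosen one by one so that each [gamma i] is within a small
    error of [m i]; the total cost at these inputs is nonnegative. *)
Lemma sum_outputs_ge0 gamma (m : forall i : nat, out_hist B i -> R) n :
  (forall i, (i <= n)%N -> forall b (e : R), (0 < e)%R ->
    exists a, (gamma i (a, b) < m i b + e)%R) ->
  (forall z, (0 <= @sum_costs R A B gamma n z)%R) ->
  forall b : out_hist B n, (0 <= sum_outputs m b)%R.
Proof.
move=> gm gamma0 b.
have H k : (k <= n)%N -> forall (b : out_hist B k) (e : R), (0 < e)%R -> exists a,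
    (sum_costs gamma (a, b) < sum_outputs m b + k.+1%:R * e)%R.
  elim: k => [|k IHk] kn {}b e e0.
    have [a ha] := gm _ kn b _ e0; exists (tt, a) => /=; lra.
  have [a ha] := IHk (ltnW kn) b.1 _ e0; have [x hx] := gm _ kn b _ e0.
  exists (a, x) => /=; rewrite (surjective_pairing b)/= in ha hx *.
  by rewrite -(natr1 k.+1) mulrDl mul1r; lra.
apply/ler_addgt0Pr => e e0.
(* The error [e] is shared equally among the n+1 summands. *)
have en : (0 < e / n.+1%:R)%R by rewrite divr_gt0.
have [a ha] := H n (leqnn n) b _ en.
have := le_lt_trans (gamma0 (a, b)) ha.
by rewrite [(n.+1%:R * _)%R]mulrC divfK// => /ltW.
Qed.

End sum_costs.

Section last_outputs.
Variable B : int -> ptopologicalType.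

(** Coordinates are continuous for the product topology, hence Borel. *)
Lemma measurable_initial_coordinate (L : nat) :
  measurable_fun setT (fun b : borel (initial_data B) => b L : borel (B (Negz L))).
Proof.
apply: (@measurability _ _ _ (borel (B (Negz L))) setT _ (@open (B (Negz L)))) => //.
move=> _ [U oU <-]; rewrite setTI; apply: sub_sigma_algebra.
apply: (@open_comp (initial_data B) (B (Negz L)) (fun b => b L)) => // b _.
exact: (@proj_continuous nat (fun j => B (Negz j)) L b).
Qed.

Lemma measurable_last_past K :
  measurable_fun setT (fun b : borel (initial_data B) => last_past K b).
Proof.
elim: K => [|L IHL]; first exact: measurable_cst.
apply: measurable_fun_pair; last exact: IHL.
exact: measurable_initial_coordinate.
Qed.

Lemma measurable_last_outputs i K : measurable_fun setT (@last_outputs B i K).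
Proof.
elim: i K => [K|i IHi [|K]].
- exact: (@measurable_last_past K).
- exact: measurable_cst.
apply: measurable_fun_pair; last exact: measurable_snd.
exact: (measurableT_comp (IHi K)
  (@measurable_fst _ _ (out_hist B i) (borel (B (Posz i))))).
Qed.

End last_outputs.

(** * Invariance of the expected cost *)

Section expected_cost_feedback_version.
Context (R : realType) (A : nat -> ptopologicalType) (B : int -> ptopologicalType).
Hypothesis retA : forall i, real_retract R (borel (A i)).
Variables (n : nat) (mu : probability (out_hist B 0) R).
Variables (W : @channel R A B) (Q : @channel_A R A B).
Hypothesis WQ : class_A n W Q.
Implicit Types (P : @input_kernels R A B) (pi : @output_feedback_kernels R A B).
Implicit Types gamma : forall i : nat, borel (A i) * out_hist B i -> R.

(** One time step is two semidirect products, by the channel and then by the next input kernel; each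
    has the preceding law as first marginal. *)
Lemma input_law_drop_last P i E : measurable E ->
  input_law mu W P i E =
  input_law mu W P i.+1 ((fun z => (z.1.1, z.2.1)) @^-1` E).
Proof.
move=> mE; pose F : set (in_hist A i.+1 * out_hist B i.+1) :=
  [set z | E (z.1, z.2.1)].
have mF : measurable F.
  have mf : measurable_fun setT (fun z : in_hist A i.+1 *
      (out_hist B i * borel (B (Posz i))) => (z.1, z.2.1)).
    by apply: measurable_fun_pair => //; exact: measurableT_comp.
  by rewrite -[X in measurable X]setTI; exact: mf.
transitivity (history_law mu W P i.+1 F).
  rewrite -[LHS](semidirect_fst _ (W i))//.
  congr (semidirect _ _ _); apply/seteqP; split=> -[[h b] y] //=.
  by case.
rewrite -[LHS](semidirect_fst _ (P i.+1))//.
congr (semidirect _ _ _); apply/seteqP; split=> -[[h b] a] //=.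
by case.
Qed.

Lemma integral_sum_costs P gamma k :
  (forall i, (i <= k)%N -> measurable_fun setT (gamma i)) ->
  (forall i w, (0 <= gamma i w)%R) ->
  \int[input_law mu W P k]_z (sum_costs gamma z)%:E =
  \sum_(i < k.+1) \int[output_input_law mu W P i]_w (gamma i (w.2, w.1))%:E.
Proof.
elim: k => [|k IHk] mgamma gamma0.
  by rewrite big_ord1 (lower_integral_last_input retA).
have mgammak i : (i <= k)%N -> measurable_fun setT (gamma i).
  by move=> ik; apply: mgamma; exact: leqW.
transitivity (\int[input_law mu W P k.+1]_z (sum_costs gamma (z.1.1, z.2.1))%:E +
    \int[input_law mu W P k.+1]_z (gamma k.+1 (z.1.2, z.2))%:E).
  rewrite -[RHS]ge0_integralD//.
  - by move=> z _; rewrite lee_fin sum_costs_ge0.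
  - apply/measurable_EFinP.
    exact: (measurableT_comp (measurable_sum_costs mgammak)
      (@measurable_drop_last _ _ _ _ (in_hist A k.+1) (borel (A k.+1))
      (out_hist B k) (borel (B (Posz k))))).
  - by move=> z _; rewrite lee_fin gamma0.
  - apply/measurable_EFinP.
    exact: (measurableT_comp (mgamma _ (leqnn _))
      (@measurable_input_output _ _ _ (in_hist A k.+1) (borel (A k.+1))
      (out_hist B k.+1))).
rewrite big_ord_recr -IHk//; congr (_ + _).
  apply/esym/ge0_integral_pushforward_eq.
  - exact: (@measurable_drop_last _ _ _ _ (in_hist A k.+1) (borel (A k.+1))
      (out_hist B k) (borel (B (Posz k)))).
  - exact: input_law_drop_last.
  - by move=> z; rewrite lee_fin sum_costs_ge0.
  - by apply/measurable_EFinP; exact: measurable_sum_costs.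
exact/esym/(lower_integral_last_input retA (input_law mu W P k.+1)).
Qed.

Lemma ae_sum_costs P gamma gamma' k :
  (forall i, (i <= k)%N ->
    {ae output_input_law mu W P i, forall w,
      gamma i (w.2, w.1) = gamma' i (w.2, w.1)}) ->
  {ae input_law mu W P k, forall z, sum_costs gamma z = sum_costs gamma' z}.
Proof.
elim: k => [|k IHk] gammaE.
  have := @ae_pushforward _ _ _ _ _ (input_law mu W P 0%N) (output_input_law mu W P 0%N)
    _ _ (@measurable_last_input _ _ _ _ _ _) (fun V _ => erefl) (gammaE 0%N (leqnn _)).
  by apply: filterS => z.
have H1 : {ae input_law mu W P k.+1, forall z,
    gamma k.+1 (z.1.2, z.2) = gamma' k.+1 (z.1.2, z.2)}.
  have := @ae_pushforward _ _ _ _ _ (input_law mu W P k.+1) (output_input_law mu W P k.+1)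
    _ _ (@measurable_last_input _ _ _ _ _ _) (fun V _ => erefl) (gammaE k.+1 (leqnn _)).
  by apply: filterS => z.
have H2 := @ae_pushforward _ _ _ _ _ (input_law mu W P k.+1) (input_law mu W P k) _ _
  (@measurable_drop_last _ _ _ _
  (in_hist A k.+1) (borel (A k.+1)) (out_hist B k) (borel (B (Posz k))))
  (@input_law_drop_last P k) (IHk (fun i ik => gammaE i (leqW ik))).
by apply: filterS2 H1 H2 => z /= -> ->.
Qed.

Lemma feedback_version_expected_cost P P' pi
    (c : in_hist A n.+1 * out_hist B n -> R) :
  feedback_version n mu W P pi -> feedback_version n mu W P' pi ->
  cost_A c -> (forall z, (0 <= c z)%R) ->
  expected_cost mu W P c = expected_cost mu W P' c.
Proof.
move=> Ppi P'pi [gamma mgamma ->] c0.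
have lb := @sum_costs_lower_bound _ _ _ gamma n (fun=> 0%R).
have {}lb i : (i <= n)%N -> forall b, exists L, forall a, (L <= gamma i (a, b))%R.
  by apply: lb => z; rewrite oppr0.
have [m mP] : exists m : forall i, out_hist B i -> R, forall i, (i <= n)%N ->
  [/\ measurable_fun setT (m i),
    forall b (e : R), (0 < e)%R -> exists a, (gamma i (a, b) < m i b + e)%R &
    forall nu : probability (out_hist B i) R,
      {ae semidirect nu (pi i), forall w, (m i w.1 <= gamma i (w.2, w.1))%R}].
  suff ex_m i : exists m : out_hist B i -> R, (i <= n)%N ->
    [/\ measurable_fun setT m,
      forall b (e : R), (0 < e)%R -> exists a, (gamma i (a, b) < m b + e)%R &
      forall nu : probability (out_hist B i) R,
        {ae semidirect nu (pi i), forall w, (m w.1 <= gamma i (w.2, w.1))%R}].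
    by exists (fun i => sval (cid (ex_m i))) => i; case: cid.
  have [ni|ni] := boolP (i <= n)%N; last by exists (fun=> 0%R).
  have [m ?] := exists_conditional_essinf (pi i) (mgamma i ni) (lb i ni).
  by exists m.
have mm i : (i <= n)%N -> measurable_fun setT (m i) by move=> /mP[].
have M0 := sum_outputs_ge0 (fun i ni => let: And3 _ H _ := mP i ni in H) c0.
(* Clamping makes the summands nonnegative everywhere, so that integrals add; almost surely nothing
   is changed. *)
pose gamma' i w : R := Num.max 0%R (gamma i w - m i w.2)%R.
have gamma'0 i w : (0 <= gamma' i w)%R by rewrite le_max lexx.
have mgamma' i : (i <= n)%N -> measurable_fun setT (gamma' i).
  move=> ni; apply: measurable_maxr => //; apply: measurable_funB; first exact: mgamma.
  by apply: measurableT_comp => //; exact: mm.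
(* The right-hand side mentions only [pi], so [P] and [P'] share its value. *)
have E P1 : feedback_version n mu W P1 pi ->
    expected_cost mu W P1 (sum_costs gamma (n:=n)) =
    \sum_(i < n.+1) \int[semidirect (output_law mu Q pi i) (pi i)]_w
       (gamma' i (w.2, w.1))%:E +
    \int[output_law mu Q pi n]_b (sum_outputs m b)%:E.
  move=> P1pi.
  transitivity (\int[input_law mu W P1 n]_z
      ((sum_costs gamma' z)%:E + (sum_outputs m z.2)%:E)).
    apply: ae_eq_lower_integral.
    have := @ae_sum_costs P1 (fun i w => gamma i w - m i w.2)%R gamma' n.
    have H i : (i <= n)%N -> {ae output_input_law mu W P1 i, forall w,
        (gamma i (w.2, w.1) - m i w.1 = gamma' i (w.2, w.1))%R}.
      move=> ni; have [_ _ Hm] := mP i ni.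
      (* The map [id] transports the almost sure bound between two measures that agree on measurable
         sets. *)
      have := @ae_pushforward _ _ _ _ _ (output_input_law mu W P1 i)
        (semidirect (output_law mu Q pi i) (pi i)) id _ (@measurable_id _ _ _)
        (fun V mV => esym (feedback_version_output_input_law retA WQ P1pi ni mV)) (Hm _).
      by apply: filterS => w /= mw; rewrite /gamma'/= max_r// subr_ge0.
    move=> /(_ H); apply: filterS => z; rewrite (sum_costs_split gamma m) => ->.
    by rewrite EFinD.
  rewrite ge0_integralD//; last 4 first.
  - by move=> z _; rewrite lee_fin sum_costs_ge0.
  - by apply/measurable_EFinP; exact: measurable_sum_costs.
  - by move=> z _; rewrite lee_fin.
  - apply/measurable_EFinP; apply: measurableT_comp => //.
    exact: measurable_sum_outputs.
  congr (_ + _).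
    rewrite integral_sum_costs//; apply: eq_bigr => -[i /= ni] _; rewrite ltnS in ni.
    apply: eq_measure_integral => E mE _.
    exact: (feedback_version_output_input_law retA WQ P1pi).
  rewrite (@ge0_integral_pushforward_eq _ _ _ _ _ (input_law mu W P1 n)
    (output_law mu Q pi n) snd) => //.
  - move=> V mV; rewrite -[LHS](feedback_version_laws retA WQ P1pi)//.
    by rewrite -[LHS]fst_output_input_law.
  - by apply/measurable_EFinP; exact: measurable_sum_outputs.
by rewrite !E.
Qed.

Lemma cost_B_cost_A K (c : in_hist A n.+1 * out_hist B n -> R) :
  cost_B K c -> cost_A c.
Proof.
move=> [gamma mgamma ->].
exists (fun i z => gamma i (z.1, last_outputs K z.2)) => // i ni.
apply: measurableT_comp; first exact: mgamma.
apply: measurable_fun_pair => //; apply: measurableT_comp => //.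
exact: measurable_last_outputs.
Qed.

End expected_cost_feedback_version.

(** * Restriction of the suprema to output feedback kernels *)

Theorem mainTheorem1 (R : realType)
    (A : nat -> ptopologicalType) (B : int -> ptopologicalType)
    (polishA : forall i : nat, polish R (A i))
    (polishB : forall j : int, polish R (B j))
    (n : nat) (mu : probability (out_hist B 0) R)
    (W : channel A B) (Q : channel_A A B) (WQ : class_A n W Q) :
  let C := ereal_sup [set directed_info mu W P n | P in [set: input_kernels A B]] in
  [/\ C = ereal_sup [set directed_info_A mu W P n Q | P in [set: input_kernels A B]],
      C = ereal_sup [set directed_info mu W P n
                    | P in [set P | depends_on_outputs_only mu W P n]] /\
      C = ereal_sup [set feedback_info mu Q pi n
                    | pi in [set: output_feedback_kernels A B]] &
      forall (c : in_hist A n.+1 * out_hist B n -> R) (kappa : R),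
        measurable_fun setT c -> (forall z, (0 <= c z)%R) -> (0 <= kappa)%R ->
        cost_A c \/ (exists K : nat, cost_B K c) ->
        let C_kappa := ereal_sup [set directed_info mu W P n
                                 | P in [set P | cost_le mu W P c kappa]] in
        C_kappa = ereal_inf [set ereal_sup
            [set directed_info mu W P n
                 - s%:E * (expected_cost mu W P c - (kappa * n.+1%:R)%:E)
            | P in [set: input_kernels A B]]
          | s in [set s : R | (0 <= s)%R]] ->
        C_kappa = ereal_sup [set directed_info mu W P n
            | P in [set P | depends_on_outputs_only mu W P n /\
                            cost_le mu W P c kappa]] /\
        C_kappa = ereal_sup [set feedback_info mu Q pi n
            | pi in [set pi | cost_le mu W (input_of_feedback pi) c kappa]]].
Proof.
have retA i : real_retract R (borel (A i)) by exact: polish_real_retract.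
have retB (i : nat) : real_retract R (borel (B i)) by exact: polish_real_retract.
have version P := exists_feedback_version retA n mu W P.
have infoE P pi (Ppi : feedback_version n mu W P pi) :=
  feedback_version_directed_info retA retB WQ Ppi.
(* Hence any [P] with version [pi] can be exchanged for [input_of_feedback pi], and the sets of
   attained values coincide. *)
have fb pi : feedback_version n mu W (input_of_feedback pi) pi.
  exact: feedback_version_input_of_feedback.
have out_only pi := input_of_feedback_depends_on_outputs_only n mu W pi.
move=> C; split; [|split|].
- by congr ereal_sup; apply/seteqP; split=> _ [P _ <-]; exists P => //;
    rewrite (directed_info_class_A mu WQ).
- congr ereal_sup; apply/seteqP; split=> _ [P PP <-]; last by exists P.
  have [pi Ppi] := version P; exists (input_of_feedback pi); first exact: out_only.
  by rewrite (infoE _ _ Ppi) (infoE _ _ (fb pi)).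
- congr ereal_sup; apply/seteqP; split=> _ [P PP <-].
    by have [pi Ppi] := version P; exists pi => //; rewrite (infoE _ _ Ppi).
  by exists (input_of_feedback P) => //; rewrite (infoE _ _ (fb P)).
move=> c kappa _ c0 _ cAB C_kappa _.
have cA : cost_A c by case: cAB => [//|[K]]; exact: cost_B_cost_A.
(* Feasibility survives the exchange because the expected cost is the same for two input families
   with a common version. *)
have cost_fb P pi : feedback_version n mu W P pi -> cost_le mu W P c kappa ->
    cost_le mu W (input_of_feedback pi) c kappa.
  move=> Ppi; rewrite /cost_le.
  by rewrite (feedback_version_expected_cost retA WQ Ppi (fb pi) cA c0).
split; congr ereal_sup; apply/seteqP; split=> _ [P PP <-].
- have [pi Ppi] := version P; exists (input_of_feedback pi).
    by split; [exact: out_only|exact: cost_fb Ppi PP].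
  by rewrite (infoE _ _ Ppi) (infoE _ _ (fb pi)).
- by case: PP => _ PP; exists P.
- have [pi Ppi] := version P; exists pi; first exact: cost_fb Ppi PP.
  by rewrite (infoE _ _ Ppi).
- by exists (input_of_feedback P) => //; rewrite (infoE _ _ (fb P)).
Qed.
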